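(* Let $G=\mathbb Z_{12}$. Then $\mathcal S(G)$ is described as follows (here $m_t$ denotes an arbitrary integer coprime to $t$, and $\mathcal P_1$ is as in the context): (a) The odd elements of $\mathcal S(G)$ coprime to $3$ are exactly all integers $m_6$ coprime to $6$. The odd elements of $\mathcal S(G)$ divisible by $3$ are exactly the integers $9m_6p$, where $p$ is a prime with $p\equiv 5\pmod{12}$, $p\equiv 7\pmod{12}$, or $p\in\mathcal P_1$, together with the integers $27m_2$. (b) The even elements of $\mathcal S(G)$ divisible by $3$ are exactly the integers $2^4\cdot 3^2m$, $m\in\mathbb Z$. The even elements of $\mathcal S(G)$ coprime to $3$ are exactly the integers $2^4m_6$; $2^5m_6p$ where $p$ is a prime with $p\equiv 5\pmod{12}$, $p\equiv 7\pmod{12}$, or $p\in\mathcal P_1$; and $2^6m_3$.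
   Context: For a finite group $G=\{g_1,\dots,g_n\}$, assign an independent variable $x_g$ to each $g\in G$; the group determinant $\mathscr D_G(x_{g_1},\dots,x_{g_n})$ is the determinant of the $n\times n$ matrix whose $(i,j)$ entry is $x_{g_ig_j^{-1}}$. Define $\mathcal S(G)=\{\mathscr D_G(x_{g_1},\dots,x_{g_n}) : x_{g_i}\in\mathbb Z\}$. $\mathbb Z_{12}$ is the cyclic group of order $12$. $\mathcal P_1$ is the set of primes $p\equiv 1\pmod{12}$ of the form $p=(6k+2)^2+(6t+3)^2$ for some integers $k,t$. *)

(* Defs.v *)
From HB Require Import structures.
From mathcomp Require Import all_boot all_order all_algebra all_fingroup.

Set Implicit Arguments.
Unset Strict Implicit.
Unset Printing Implicit Defensive.

Import GRing.Theory Num.Theory.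
Local Open Scope ring_scope.

(* A reordering of the group elements permutes rows and columns simultaneously,
   so using the enumeration of [gT] fixes an immaterial choice. *)
Definition group_matrix (gT : finGroupType) (R : comNzRingType) (x : gT -> R) :
    'M[R]_#|gT| :=
  \matrix_(i < #|gT|, j < #|gT|) x (enum_val i * (enum_val j)^-1)%g.

Definition group_det (gT : finGroupType) (R : comNzRingType) (x : gT -> R) : R :=
  \det (group_matrix x).

Definition int_group_dets (gT : finGroupType) (n : int) : Prop :=
  exists x : gT -> int, n = group_det x.

Definition P1_prime (p : nat) : Prop :=
  [/\ prime p, p = 1 %[mod 12]
    & exists k t : int, p%:Z = (6 * k + 2) ^+ 2 + (6 * t + 3) ^+ 2].

Definition admissible_prime (p : nat) : Prop :=
  [\/ prime p /\ p = 5 %[mod 12], prime p /\ p = 7 %[mod 12] | P1_prime p].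

(* Main.v *)
Require Import Defs.
From HB Require Import structures.
From mathcomp Require Import all_boot all_order all_algebra all_fingroup.
From mathcomp Require Import algC cyclotomic cyclic finfield.
From mathcomp Require Import zify ring.
From Stdlib Require Import Classical_Prop.

(** Write a function on Z/12 as f(x w) with x^4 = 1 and w^3 = 1, that is
    f(x w) = P0(x) + P1(x) w + P2(x) w^2 with P0, P1, P2 in Z[C_4]. The product
    over w is S(x) q(A(x), B(x)) with S = P0 + P1 + P2, A = P0 - P2, B = P1 - P2
    and q(a, b) = a^2 - a b + b^2, so the determinant is the product of these
    values at x = 1, -1 and of the norm of the value at x = i. The triples of
    values (S, A, B) that occur are those which glue at 2 (they come from Z[C_4])
    and satisfy S = A + B modulo 3.

    Necessity: put Q(x) = q(A(x), B(x)). If n / 9 or n / 32 had no admissible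
    prime factor, then Q(1) and Q(-1) (up to a factor 3) would be 1 modulo 4,
    while Q(i) and the odd part of S(i) would be congruent modulo 6 to an integer
    or i times an integer; as Q(i) = S(i)^2 modulo 3 and the parity of Q(i) is
    determined by (Q(1) + Q(-1)) / 2, this is contradictory.

    Sufficiency: the values are prescribed explicitly. For p = 5, 7, 1 modulo 12
    the prime is used as a norm from Z[i], Z[w] and Z[i, w] respectively, at
    x w = i, -w and i w; it is such a norm by a Fermat descent. *)

Set Implicit Arguments.
Unset Strict Implicit.
Unset Printing Implicit Defensive.

Import GRing.Theory Num.Theory.
Local Open Scope ring_scope.

(** * Gaussian integers and the group ring of C_4 *)

Record gauss := Gauss { re : int; im : int }.

Definition gauss_pair (z : gauss) : int * int := (re z, im z).
Definition pair_gauss (u : int * int) : gauss := Gauss u.1 u.2.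
Lemma gauss_pairK : cancel gauss_pair pair_gauss.
Proof. by case. Qed.

HB.instance Definition _ := Choice.copy gauss (can_type gauss_pairK).

Definition gauss_add (z w : gauss) := Gauss (re z + re w) (im z + im w).
Definition gauss_opp (z : gauss) := Gauss (- re z) (- im z).
Definition gauss_mul (z w : gauss) :=
  Gauss (re z * re w - im z * im w) (re z * im w + im z * re w).

Lemma gauss_addA : associative gauss_add.
Proof. by move=> [a b] [c d] [e f]; congr Gauss; rewrite /= addrA. Qed.
Lemma gauss_addC : commutative gauss_add.
Proof. by move=> [a b] [c d]; congr Gauss; rewrite /= addrC. Qed.
Lemma gauss_add0 : left_id (Gauss 0 0) gauss_add.
Proof. by move=> [a b]; congr Gauss; rewrite /= add0r. Qed.
Lemma gauss_addN : left_inverse (Gauss 0 0) gauss_opp gauss_add.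
Proof. by move=> [a b]; congr Gauss; rewrite /= addNr. Qed.

HB.instance Definition _ :=
  GRing.isZmodule.Build gauss gauss_addA gauss_addC gauss_add0 gauss_addN.

Lemma gauss_mulA : associative gauss_mul.
Proof. by move=> [a b] [c d] [e f]; congr Gauss => /=; ring. Qed.
Lemma gauss_mulC : commutative gauss_mul.
Proof. by move=> [a b] [c d]; congr Gauss => /=; ring. Qed.
Lemma gauss_mul1 : left_id (Gauss 1 0) gauss_mul.
Proof. by move=> [a b]; congr Gauss => /=; ring. Qed.
Lemma gauss_mulD : left_distributive gauss_mul gauss_add.
Proof. by move=> [a b] [c d] [e f]; congr Gauss => /=; ring. Qed.

HB.instance Definition _ := GRing.Zmodule_isComNzRing.Build gauss
  gauss_mulA gauss_mulC gauss_mul1 gauss_mulD isT.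

Lemma gaussE (z w : gauss) : re z = re w -> im z = im w -> z = w.
Proof. by case: z w => [a b] [c d] /= -> ->. Qed.

Lemma reD (z w : gauss) : re (z + w) = re z + re w. Proof. by []. Qed.
Lemma imD (z w : gauss) : im (z + w) = im z + im w. Proof. by []. Qed.
Lemma reN (z : gauss) : re (- z) = - re z. Proof. by []. Qed.
Lemma imN (z : gauss) : im (- z) = - im z. Proof. by []. Qed.
Lemma reM (z w : gauss) : re (z * w) = re z * re w - im z * im w.
Proof. by []. Qed.
Lemma imM (z w : gauss) : im (z * w) = re z * im w + im z * re w.
Proof. by []. Qed.
Lemma re0 : re 0 = 0. Proof. by []. Qed.
Lemma im0 : im 0 = 0. Proof. by []. Qed.
Lemma re1 : re 1 = 1. Proof. by []. Qed.
Lemma im1 : im 1 = 0. Proof. by []. Qed.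
Definition reimE := (reD, imD, reN, imN, reM, imM, re0, im0, re1, im1).

Definition gauss_norm (z : gauss) : int := re z ^+ 2 + im z ^+ 2.

Lemma gauss_normM (z w : gauss) : gauss_norm (z * w) = gauss_norm z * gauss_norm w.
Proof. by rewrite /gauss_norm !reimE; ring. Qed.

(* [qform a b] is the norm of [a + b w] for [w] a primitive cube root of 1. *)
Definition qform (R : comNzRingType) (a b : R) : R := a ^+ 2 - a * b + b ^+ 2.

(* The image of [Z[C_4]] in [Z * Z * Z[i]] under evaluation at [1, -1, i]. *)
Definition glued (u v : int) (z : gauss) : Prop :=
  exists f0 f1 f2 f3 : int,
    [/\ u = f0 + f1 + f2 + f3, v = f0 - f1 + f2 - f3
      & z = Gauss (f0 - f2) (f1 - f3)].

(** Fourier inversion on C_4: each coefficient is a quarter of a signed sum of [u], [v] and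
    [2 * re z] or [2 * im z]. Changing the sign of the last term alters the sum by a multiple of 4,
    so two integrality conditions suffice. *)
Lemma gluedP (u v : int) (z : gauss) :
  glued u v z <->
  (4 %| u + v - 2 * re z)%Z && (4 %| u - v - 2 * im z)%Z.
Proof.
split=> [[f0 [f1 [f2 [f3 [-> -> ->]]]]] /= | ]; first by lia.
case: z => x y /= h.
exists ((u + v + 2 * x) %/ 4)%Z, ((u - v + 2 * y) %/ 4)%Z.
exists ((u + v - 2 * x) %/ 4)%Z, ((u - v - 2 * y) %/ 4)%Z.
by split; last congr Gauss; lia.
Qed.

(** Evaluation is a ring morphism; the witnesses are the coefficients of the product in [Z[C_4]]. *)
Lemma gluedM (u v u' v' : int) (z z' : gauss) :
  glued u v z -> glued u' v' z' -> glued (u * u') (v * v') (z * z').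
Proof.
move=> [f0 [f1 [f2 [f3 [-> -> ->]]]]] [g0 [g1 [g2 [g3 [-> -> ->]]]]].
exists (f0 * g0 + f1 * g3 + f2 * g2 + f3 * g1).
exists (f0 * g1 + f1 * g0 + f2 * g3 + f3 * g2).
exists (f0 * g2 + f1 * g1 + f2 * g0 + f3 * g3).
exists (f0 * g3 + f1 * g2 + f2 * g1 + f3 * g0).
by split; [ring | ring | apply: gaussE; rewrite !reimE /=; ring].
Qed.

Lemma gluedD (u v u' v' : int) (z z' : gauss) :
  glued u v z -> glued u' v' z' -> glued (u + u') (v + v') (z + z').
Proof. by rewrite !gluedP !reimE; lia. Qed.

Lemma gluedN (u v : int) (z : gauss) :
  glued u v z -> glued (- u) (- v) (- z).
Proof. by rewrite !gluedP !reimE; lia. Qed.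

Lemma glued_qform (u v u' v' : int) (z z' : gauss) :
  glued u v z -> glued u' v' z' ->
  glued (qform u u') (qform v v') (qform z z').
Proof.
move=> g g'; rewrite /qform !expr2.
by apply: gluedD; [apply: gluedD; last apply: gluedN|]; apply: gluedM.
Qed.

(** * Group determinants of cyclic groups *)

Section GroupDeterminant.

Variables (gT : finGroupType) (R : comNzRingType).

Definition convolution (x y : gT -> R) (g : gT) : R :=
  \sum_h x h * y (h^-1 * g)%g.

Lemma group_detM (x y : gT -> R) :
  group_det (convolution x y) = group_det x * group_det y.
Proof.
rewrite /group_det -det_mulmx; congr (\det _); apply/matrixP => i j.
rewrite !mxE /convolution.
(* This substitution turns the factor [x h] into an entry of row [i] of the group matrix. *)
pose f (h : gT) := (enum_val i * h^-1)%g.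
rewrite (reindex_inj (h := f)) /=; last first.
  by move=> h1 h2 /mulgI /invg_inj.
rewrite (reindex (@enum_val gT xpredT)) /=; last first.
  by exists enum_rank => k _; rewrite ?enum_valK ?enum_rankK.
apply: eq_bigr => k _; rewrite !mxE /f; congr (_ * y _).
by rewrite invMg invgK mulgA mulgKV.
Qed.

End GroupDeterminant.

Lemma int_group_detsM (gT : finGroupType) (m n : int) :
  int_group_dets gT m -> int_group_dets gT n -> int_group_dets gT (m * n).
Proof. by move=> [x ->] [y ->]; exists (convolution x y); rewrite group_detM. Qed.

Section CyclicDeterminant.

Variables (n : nat) (F : fieldType) (z : F).
Hypothesis z_prim : n.+2.-primitive_root z.

Lemma prim_root_expMDl (a b c : 'Z_n.+2) :
  z ^+ ((a + b)%R * c)%N = z ^+ (a * c)%N * z ^+ (b * c)%N.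
Proof.
rewrite -exprD -mulnDl ![z ^+ (_ * c)%N]exprM; congr (_ ^+ _).
by rewrite -(prim_expr_mod z_prim (a + b)%N).
Qed.

(** Both sides are inverse to [z ^+ (a * c)]. *)
Lemma prim_root_expNC (a c : 'Z_n.+2) :
  z ^+ ((- a)%R * c)%N = z ^+ (a * (- c)%R)%N.
Proof.
apply: (mulfI (x := z ^+ (a * c)%N)).
  rewrite expf_neq0 //; apply/eqP => z0; have := prim_expr_order z_prim.
  by rewrite z0 expr0n => /esym/eqP; rewrite oner_eq0.
rewrite -prim_root_expMDl subrr [in RHS]mulnC [X in _ * z ^+ X]mulnC.
by rewrite -prim_root_expMDl subrr.
Qed.

Lemma prim_root_orthogonality (a : 'Z_n.+2) :
  \sum_(c : 'Z_n.+2) z ^+ (a * c)%N = if a == 0 then n.+2%:R else 0.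
Proof.
case: eqP => [-> | /eqP a_neq0].
  under eq_bigr => c _ do rewrite mul0n expr0.
  by rewrite sumr_const card_ord.
under eq_bigr => c _ do rewrite exprM.
have za : z ^+ a != 1.
  rewrite -(prim_order_dvd z_prim); apply: contra a_neq0 => /dvdn_leq.
  case: a => [[|a] /= ha]; first by [].
  by move=> /(_ isT); rewrite leqNgt ha.
apply: (mulfI (x := z ^+ a - 1)); first by rewrite subr_eq0.
rewrite mulr0 -subrX1 -exprM mulnC exprM.
by rewrite (prim_expr_order z_prim) expr1n subrr.
Qed.

(** The character table [V] diagonalizes the group matrix, and orthogonality makes [V]
    invertible. *)
Lemma group_det_Zp (x : 'Z_n.+2 -> F) : n.+2%:R != 0 :> F ->
  group_det x = \prod_(c : 'Z_n.+2) \sum_(g : 'Z_n.+2) x g * z ^+ (g * c)%N.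
Proof.
move=> n_neq0.
pose e := @enum_val 'Z_n.+2 xpredT.
have e_bij : {on predT, bijective e}.
  by exists enum_rank => k _; rewrite /e ?enum_valK ?enum_rankK.
pose V := \matrix_(i, j) z ^+ (e i * e j)%N.
pose W := \matrix_(i, j) z ^+ (e i * (- e j)%R)%N.
pose d c := \sum_(g : 'Z_n.+2) x g * z ^+ (g * c)%N.
have VW : V *m W = n.+2%:R%:M.
  apply/matrixP => i j; rewrite !mxE.
  have := prim_root_orthogonality (e i - e j); rewrite subr_eq0.
  rewrite (inj_eq enum_val_inj) mulrb => <-.
  rewrite [RHS](reindex e) //; apply: eq_bigr => k _; rewrite !mxE.
  by rewrite prim_root_expMDl [in RHS]prim_root_expNC [X in _ = _ * z ^+ X]mulnC
             -prim_root_expNC mulnC.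
have detV : \det V != 0.
  apply/eqP => V0; have := congr1 (fun A => \det A) VW.
  rewrite det_mulmx V0 mul0r det_scalar => /esym/eqP.
  by rewrite expf_eq0 (negPf n_neq0) andbF.
(* Column [j] of [V] is an eigenvector. The entry [x (e i - e k)] produces the transform at [- e j];
   the final reindexing by negation removes this sign. *)
have MV : group_matrix x *m V = V *m diag_mx (\row_j d (- e j)).
  apply/matrixP => i j; rewrite mul_mx_diag !mxE /d mulr_sumr.
  rewrite [RHS](reindex (fun k => e i - e k)); last first.
    exists (fun h => enum_rank (e i - h)) => k _.
      by rewrite opprB addrCA subrr addr0 enum_valK.
    by rewrite /e enum_rankK opprB addrCA subrr addr0.
  apply: eq_bigr => k _; rewrite !mxE mulrCA; congr (x _ * _).
  by rewrite -prim_root_expNC opprB -prim_root_expMDl addrC subrK.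
apply: (mulIf detV); rewrite -det_mulmx MV det_mulmx mulrC det_diag.
congr (_ * _); rewrite [RHS](reindex (fun j => - e j)).
  by apply: eq_bigr => j _; rewrite mxE.
exists (fun c => enum_rank (- c)) => k _.
  by rewrite opprK enum_valK.
by rewrite /e enum_rankK opprK.
Qed.

End CyclicDeterminant.

(** * The twelve characters of Z/12 *)

Section Order12.

Variables (F : fieldType) (w : F).
Hypothesis w2 : w ^+ 2 = - 1 - w.

(** Chinese remainders: the exponent [g] contributes [y] to the power [g] mod 4 and [v] to the power
    [g] mod 3. *)
Lemma sum_powers_CRT (x : nat -> F) (y v : F) :
  y ^+ 4 = 1 -> v ^+ 3 = 1 ->
  \sum_(g < 12) x g * (y * v) ^+ g =
    (x 0 + x 9 * y + x 6 * y ^+ 2 + x 3 * y ^+ 3)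
    + (x 4 + x 1 * y + x 10 * y ^+ 2 + x 7 * y ^+ 3) * v
    + (x 8 + x 5 * y + x 2 * y ^+ 2 + x 11 * y ^+ 3) * v ^+ 2.
Proof. move=> y4 v3; rewrite !big_ord_recl big_ord0 /= /bump /=; ring: y4 v3. Qed.

(** Since [w ^+ 2 = - 1 - w], the factor at [w] is [(p0 - p2) + (p1 - p2) * w], and the factor at
    [w ^+ 2] is its conjugate. *)
Lemma prod_cube_roots (p0 p1 p2 : F) :
  (p0 + p1 + p2) * (p0 + p1 * w + p2 * w ^+ 2)
    * (p0 + p1 * w ^+ 2 + p2 * (w ^+ 2) ^+ 2)
  = (p0 + p1 + p2) * qform (p0 - p2) (p1 - p2).
Proof. rewrite /qform; ring: w2. Qed.

End Order12.

(* The first three arguments are the values at [1, -1, i] of [S = P0 + P1 + P2];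
   the others are those of [A = P0 - P2] and [B = P1 - P2]. *)
Definition det_value (s1 sm : int) (s : gauss) (a1 b1 am bm : int)
    (a b : gauss) : int :=
  s1 * sm * gauss_norm s * qform a1 b1 * qform am bm * gauss_norm (qform a b).

Section GaussEvaluation.

Variables (F : fieldType) (i : F).
Hypothesis i2 : i ^+ 2 = -1.

Definition gauss_eval (j : F) (z : gauss) : F := (re z)%:~R + (im z)%:~R * j.

Lemma gauss_evalD (j : F) (z w : gauss) :
  gauss_eval j (z + w) = gauss_eval j z + gauss_eval j w.
Proof. by rewrite /gauss_eval !reimE !rmorphD /=; ring. Qed.

Lemma gauss_evalN (j : F) (z : gauss) : gauss_eval j (- z) = - gauss_eval j z.
Proof. by rewrite /gauss_eval !reimE !rmorphN /=; ring. Qed.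

Lemma gauss_evalM (j : F) (z w : gauss) : j ^+ 2 = -1 ->
  gauss_eval j (z * w) = gauss_eval j z * gauss_eval j w.
Proof.
by move=> j2; rewrite /gauss_eval !reimE rmorphB rmorphD !rmorphM /=; ring: j2.
Qed.

Lemma gauss_eval_qform (j : F) (z w : gauss) : j ^+ 2 = -1 ->
  gauss_eval j (qform z w) = qform (gauss_eval j z) (gauss_eval j w).
Proof.
move=> j2.
by rewrite /qform !expr2 !(gauss_evalD, gauss_evalN) !gauss_evalM.
Qed.

Lemma gauss_normE (z : gauss) :
  (gauss_norm z)%:~R = gauss_eval i z * gauss_eval (- i) z.
Proof. by rewrite /gauss_eval rmorphD !rmorphXn /=; ring: i2. Qed.

End GaussEvaluation.

Section Order12Determinant.

Variables (x : 'Z_12 -> int).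

Let X (k : nat) : int := x (inord k).
(* [p_j] lists the coefficients of exponent congruent to [j] modulo 3, ordered by
   the class of the exponent modulo 4. *)
Let p0 := [:: X 0; X 9; X 6; X 3].
Let p1 := [:: X 4; X 1; X 10; X 7].
Let p2 := [:: X 8; X 5; X 2; X 11].
Let val1 (f : seq int) : int := f`_0 + f`_1 + f`_2 + f`_3.
Let valm (f : seq int) : int := f`_0 - f`_1 + f`_2 - f`_3.
Let vali (f : seq int) : gauss := Gauss (f`_0 - f`_2) (f`_1 - f`_3).

Lemma group_det_Z12 :
  group_det x = det_value
    (val1 p0 + val1 p1 + val1 p2) (valm p0 + valm p1 + valm p2)
    (vali p0 + vali p1 + vali p2)
    (val1 p0 - val1 p2) (val1 p1 - val1 p2)
    (valm p0 - valm p2) (valm p1 - valm p2)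
    (vali p0 - vali p2) (vali p1 - vali p2).
Proof.
have [z z_prim] := C_prim_root_exists (isT : (0 < 12)%N).
(* The exponents 9 and 4 are the idempotents of Z/12 for the moduli 4 and 3; their sum is 13, so
   [z = i * w]. *)
pose i := z ^+ 9; pose w := z ^+ 4.
have z12 : z ^+ 12 = 1 := prim_expr_order z_prim.
have z6 : z ^+ 6 = -1.
  apply/eqP; rewrite -addr_eq0.
  have : (z ^+ 6 - 1) * (z ^+ 6 + 1) == 0.
    by rewrite -subr_sqr -exprM z12 expr1n subrr.
  rewrite mulf_eq0 => /orP[|//]; rewrite subr_eq0 => /eqP z6.
  by have := prim_order_dvd z_prim 6; rewrite z6 eqxx.
have i2 : i ^+ 2 = -1 by rewrite -exprM (exprD _ 12 6) z12 z6 mul1r.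
have w3 : w ^+ 3 = 1 by rewrite -exprM.
have w2 : w ^+ 2 = - 1 - w.
  apply/eqP; rewrite -subr_eq0.
  have : (w - 1) * (w ^+ 2 - (- 1 - w)) == 0.
    by apply/eqP; transitivity (w ^+ 3 - 1); [ring | rewrite w3 subrr].
  rewrite mulf_eq0 => /orP[|//]; rewrite (subr_eq0 w 1) => /eqP w1.
  by have := prim_order_dvd z_prim 4; rewrite -/w w1 eqxx.
have ziw : z = i * w by rewrite -exprD (exprD _ 12 1) z12 mul1r.
have i4 : i ^+ 4 = 1 by rewrite (exprM i 2 2) i2 sqrrN expr1n.
pose Q (f : seq int) (y : algC) :=
  (f`_0)%:~R + (f`_1)%:~R * y + (f`_2)%:~R * y ^+ 2 + (f`_3)%:~R * y ^+ 3.
pose L y v := Q p0 y + Q p1 y * v + Q p2 y * v ^+ 2.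
apply: (@intr_inj algC); rewrite -[LHS](det_map_mx intr).
have -> : map_mx intr (group_matrix x) = group_matrix (intr \o x) :> 'M[algC]__.
  by apply/matrixP => j k; rewrite !mxE.
rewrite -/(group_det (intr \o x)) (group_det_Zp z_prim) ?pnatr_eq0 //.
have LE (c : 'Z_12) : \sum_(g : 'Z_12) (intr \o x) g * z ^+ (g * c)%N
    = L (i ^+ c) (w ^+ c).
  transitivity (\sum_(g < 12) (X g)%:~R * (i ^+ c * w ^+ c) ^+ g).
    apply: eq_bigr => g _; rewrite /X inord_val /= mulnC exprM.
    by rewrite [in LHS]ziw exprMn.
  rewrite (@sum_powers_CRT algC (fun k => (X k)%:~R)) //.
  - by rewrite -exprM mulnC exprM i4 expr1n.
  - by rewrite -exprM mulnC exprM w3 expr1n.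
pose l k := L (i ^+ (k %% 4)) (w ^+ (k %% 3)).
have ll (c : 'Z_12) : \sum_(g : 'Z_12) (intr \o x) g * z ^+ (g * c)%N = l c.
  by rewrite LE /l !expr_mod.
rewrite (eq_bigr _ (fun c _ => ll c)) !big_ord_recl big_ord0.
(* [M y] collects the three cube roots of unity, so the twelve characters are regrouped by the power
   of [i]. *)
pose M y := L y 1 * L y w * L y (w ^+ 2).
transitivity (M 1 * M i * M (i ^+ 2) * M (i ^+ 3)).
  transitivity (l 0 * l 1 * l 2 * l 3 * l 4 * l 5 * l 6 * l 7 * l 8 * l 9
                * l 10 * l 11).
    by rewrite mulr1 !mulrA.
  rewrite /M /l /modn /= !expr0 !expr1; ring.
have ME y : M y = (Q p0 y + Q p1 y + Q p2 y)
                  * qform (Q p0 y - Q p2 y) (Q p1 y - Q p2 y).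
  by rewrite /M /L !expr1n !mulr1 (prod_cube_roots w2).
have Q1 f : Q f 1 = (val1 f)%:~R.
  by rewrite /Q /val1 !rmorphD /= !expr1n !mulr1.
have Qm f : Q f (-1) = (valm f)%:~R.
  by rewrite /Q /valm !(rmorphD, rmorphN) /=; ring.
have Qi (j : algC) f : j ^+ 2 = -1 -> Q f j = gauss_eval j (vali f).
  by move=> j2; rewrite /Q /gauss_eval /= !rmorphB /=; ring: j2.
have Ni2 : (- i) ^+ 2 = -1 by rewrite sqrrN.
have i3 : i ^+ 3 = - i by rewrite exprS i2 mulrN1.
rewrite i2 i3 !ME !Q1 !Qm !Qi //.
rewrite -!(gauss_evalD, gauss_evalN, gauss_eval_qform) //.
rewrite /det_value !rmorphM /= !(gauss_normE i2) /qform.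
move: (val1 p0) (val1 p1) (val1 p2) (valm p0) (valm p1) (valm p2).
move: (vali p0 + vali p1 + vali p2) (vali p0 - vali p2) (vali p1 - vali p2).
move=> s a b u0 u1 u2 v0 v1 v2.
rewrite !(rmorphD, rmorphN, rmorphM, rmorphXn) /=; ring.
Qed.

End Order12Determinant.

(** As [S - A - B = 3 P2], the congruences modulo 3 are what is needed to recover [P2], and then
    [P0 = A + P2] and [P1 = B + P2]. *)
Lemma int_group_dets_Z12P (n : int) :
  int_group_dets 'Z_12 n <->
  exists (s1 sm : int) (s : gauss) (a1 am : int) (a : gauss)
         (b1 bm : int) (b : gauss),
    [/\ glued s1 sm s, glued a1 am a, glued b1 bm b,
        [&& 3 %| s1 - a1 - b1, 3 %| sm - am - bm,
            3 %| re s - re a - re b & 3 %| im s - im a - im b]%Z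
      & n = det_value s1 sm s a1 b1 am bm a b].
Proof.
split=> [[x ->]|].
  pose X k := x (inord k); rewrite group_det_Z12.
  do 9 eexists; split; last by [].
  - exists (X 0 + X 4 + X 8), (X 9 + X 1 + X 5), (X 6 + X 10 + X 2),
      (X 3 + X 7 + X 11).
    by split; [| |apply: gaussE]; rewrite ?reimE /=; ring.
  - exists (X 0 - X 8), (X 9 - X 5), (X 6 - X 2), (X 3 - X 11).
    by split; [| |apply: gaussE]; rewrite ?reimE /=; ring.
  - exists (X 4 - X 8), (X 1 - X 5), (X 10 - X 2), (X 7 - X 11).
    by split; [| |apply: gaussE]; rewrite ?reimE /=; ring.
  - by rewrite !reimE /=; apply/and4P; split; lia.
move=> [s1 [sm [s [a1 [am [a [b1 [bm [b [gs ga gb]]]]]]]]]].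
case: gs ga gb => [s0' [s1' [s2' [s3' [-> -> ->]]]]].
move=> [a0' [a1' [a2' [a3' [-> -> ->]]]]] [b0' [b1' [b2' [b3' [-> -> ->]]]]] /=.
move=> h3 ->.
(* These are the coefficients of [P2]. Divisibility by 3 passes from the values at 1, -1, i to the
   coefficients because 4 is invertible modulo 3. *)
pose c0 := ((s0' - a0' - b0') %/ 3)%Z.
pose c1 := ((s1' - a1' - b1') %/ 3)%Z.
pose c2 := ((s2' - a2' - b2') %/ 3)%Z.
pose c3 := ((s3' - a3' - b3') %/ 3)%Z.
have [e0 e1 e2 e3] : [/\ s0' = a0' + b0' + 3 * c0, s1' = a1' + b1' + 3 * c1,
    s2' = a2' + b2' + 3 * c2 & s3' = a3' + b3' + 3 * c3].
  by rewrite /c0 /c1 /c2 /c3; split; lia.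
(* The residue of the position modulo 3 selects [P0], [P1] or [P2], and its residue modulo 4 selects
   the coefficient. *)
pose l := [:: a0' + c0; b1' + c1; c2; a3' + c3; b0' + c0; c1;
              a2' + c2; b3' + c3; c0; a1' + c1; b2' + c2; c3].
exists (fun g : 'I_12 => l`_g); rewrite group_det_Z12 !inordK //= e0 e1 e2 e3.
congr det_value; rewrite ?reimE /=; try ring.
- by apply: gaussE; rewrite !reimE /=; ring.
- by apply: gaussE; rewrite !reimE /=; ring.
- by apply: gaussE; rewrite !reimE /=; ring.
Qed.

(** * Norms in Z[i], Z[w] and Z[i, w] *)

Section Descent.

Variables (R : comNzRingType) (N : R -> nat) (e : R).
Hypothesis NM : {morph N : x y / x * y >-> (x * y)%N}.
Hypothesis N_eq0 : forall x, (N x == 0%N) = (x == 0).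

(** One descent serves three cases: [e = 0] over the integers gives sums of two squares, [e = 1]
    gives [qform], over the integers and over Z[i]. *)
Definition form (a b : R) : R := a ^+ 2 - e * a * b + b ^+ 2.

Hypothesis form_eq0 : forall a b, form a b = 0 -> a = 0 /\ b = 0.
Hypothesis form_reduce : forall m a b, m != 0 ->
  exists k l, (N (form (a - m * k) (b - m * l)) < N m ^ 2)%N.

Lemma norm_mulfI (m x y : R) : m != 0 -> m * x = m * y -> x = y.
Proof.
move=> m_neq0 /eqP; rewrite -subr_eq0 -mulrBr -N_eq0 NM muln_eq0 !N_eq0.
by rewrite (negPf m_neq0) subr_eq0 => /eqP.
Qed.

Let cotrace a b k l := a * k + a * k + b * l + b * l - e * (a * l + b * k).

(** The cofactor of [m] is also the new multiplier in [form_descent]; a reduced pair therefore makes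
    the multiplier smaller. *)
Lemma form_shift (p m a b k l : R) : form a b = p * m ->
  form (a - m * k) (b - m * l) = m * (p - cotrace a b k l + m * form k l).
Proof.
move=> h; transitivity (form a b + m * (m * form k l - cotrace a b k l)).
  by rewrite /form /cotrace; ring.
by rewrite h; ring.
Qed.

(* The pair is [theta * conj (theta - m * psi) / m] for [theta = a + b t] and
   [psi = k + l t], where [t] is a root of [X^2 + e X + 1]. *)
Lemma form_descent (p m a b k l : R) : form a b = p * m ->
  form (p - (a * k + b * l - e * a * l)) (a * l - b * k)
  = p * (p - cotrace a b k l + m * form k l).
Proof.
move=> h; transitivity (p * (p - cotrace a b k l) + form a b * form k l).
  by rewrite /form /cotrace; ring.
by rewrite h; ring.
Qed.

(** Fermat descent on the multiplier [m] in [form a b = p * m]: reducing the pair modulo [m] lowers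
    [N m] until it is 1. *)
Lemma form_represents_prime (p s nu : R) :
  prime (N p) -> form s 1 = p * nu -> exists a b, N (form a b) = N p.
Proof.
move=> p_prime hs; have Np_gt1 := prime_gt1 p_prime.
have p_neq0 : p != 0 by rewrite -N_eq0; lia.
have descent : forall n m a b, N m = n -> (0 < n < N p)%N ->
    form a b = p * m -> exists a b, N (form a b) = N p.
  elim/ltn_ind => n IH m a b Nm /andP[n_gt0 n_lt] h.
  have m_neq0 : m != 0 by rewrite -N_eq0; lia.
  have [n1|n_neq1] := eqVneq n 1%N.
    by exists a, b; rewrite h NM Nm n1 muln1.
  have [k [l lt_m]] := form_reduce a b m_neq0.
  set m' := p - cotrace a b k l + m * form k l.
  have e1 := form_shift k l h; have e2 := form_descent k l h.
  rewrite -/m' in e1 e2.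
  (* If [m'] vanished, then [a = m * k] and [b = m * l], so [p = m * form k l] and [N m] would be a
     divisor of the prime [N p] strictly between 1 and [N p]. *)
  have [m'0|m'_neq0] := eqVneq m' 0.
    move: e1; rewrite m'0 mulr0 => /form_eq0[/eqP]; rewrite subr_eq0.
    move=> /eqP ea /eqP; rewrite subr_eq0 => /eqP eb.
    have pE : p = m * form k l.
      apply: (norm_mulfI m_neq0); rewrite mulrC -h ea eb /form; ring.
    have /primeP[_ /(_ n)] := p_prime; rewrite {1}pE NM Nm dvdn_mulr //.
    by move=> /(_ isT) /orP[] /eqP; lia.
  apply: (IH (N m') _ m' _ _ erefl _ e2).
    move: lt_m; rewrite e1 NM Nm; nia.
  rewrite lt0n N_eq0 m'_neq0 /=.
  by move: lt_m; rewrite e1 NM Nm; nia.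
(* Reducing modulo [p] itself starts the descent with a multiplier of norm below [N p]. *)
have [k [l lt_p]] := form_reduce s 1 p_neq0.
have e1 := form_shift k l hs.
have es : form (s - p * k) (1 - p * l)
    = p * (nu - cotrace s 1 k l + p * form k l).
  transitivity (form s 1 + p * (p * form k l - cotrace s 1 k l)).
    by rewrite /form /cotrace; ring.
  by rewrite hs; ring.
apply: (descent _ _ _ _ erefl _ es).
rewrite lt0n N_eq0; apply/andP; split; last first.
  by move: lt_p; rewrite es NM; nia.
(* A zero multiplier would give [p * l = 1], hence [N p] would divide 1. *)
apply/eqP => m0; move: es; rewrite m0 mulr0 => /form_eq0[_ /eqP].
rewrite subr_eq0 => /eqP pl; have := congr1 N pl.
have : N 1 = 1%N.
  have : N 1 != 0%N by rewrite N_eq0 oner_neq0.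
  by have := NM 1 1; rewrite mulr1; nia.
by move=> -> /esym/eqP; rewrite NM muln_eq1; lia.
Qed.

End Descent.

(** * Euclidean reduction in the square and hexagonal lattices *)

Lemma int_reduce (n x : int) : n != 0 ->
  exists k : int, 4 * (x - n * k) ^+ 2 <= n ^+ 2.
Proof.
move=> n_neq0; pose m := `|n|; have m_gt0 : 0 < m by rewrite normr_gt0.
(* This rounds [x / m] to a nearest integer. *)
pose k := ((2 * x + m) %/ (2 * m))%Z.
have [h1 h2] : - m <= 2 * (x - m * k) /\ 2 * (x - m * k) <= m.
  have h := divz_eq (2 * x + m) (2 * m); rewrite -/k in h.
  have := modz_ge0 (2 * x + m) (_ : 2 * m != 0).
  have := ltz_pmod (2 * x + m) (_ : 0 < 2 * m).
  by move: h; set r := (_ %% _)%Z; nia.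
have mn : m = n \/ m = - n by rewrite /m; lia.
have sq : (2 * (x - m * k)) ^+ 2 <= m ^+ 2.
  by rewrite -[leLHS]ger0_norm ?sqr_ge0 // normrX ler_sqr ?nnegrE
             ?ler_norml ?h1 //; lia.
case: mn => mn; [exists k | exists (- k)]; rewrite mn in sq.
  by rewrite exprMn in sq.
by rewrite exprMn sqrrN mulNr -mulrN in sq.
Qed.

Lemma qformC (R : comNzRingType) (a b : R) : qform a b = qform b a.
Proof. by rewrite /qform; ring. Qed.

(* Some vertex of the equilateral triangle [0, n, n + n w] is within [n / sqrt 3]
   of [a + b w], since the barycentric average of the squared distances is. *)
Lemma triangle_vertex (n a b : int) : 0 <= b <= a -> a < n ->
  [\/ 3 * qform a b <= n ^+ 2, 3 * qform (a - n) b <= n ^+ 2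
    | 3 * qform (a - n) (b - n) <= n ^+ 2].
Proof.
move=> /andP[b_ge0 ba] an.
have [|h0] := lerP (3 * qform a b) (n ^+ 2); first by constructor 1.
have [|h1] := lerP (3 * qform (a - n) b) (n ^+ 2); first by constructor 2.
have [|h2] := lerP (3 * qform (a - n) (b - n)) (n ^+ 2); first by constructor 3.
pose q0 := qform a b; pose q1 := qform (a - n) b.
pose q2 := qform (a - n) (b - n).
(* The barycentric coordinates of the point with respect to 0, n, n + n w are [n - a], [a - b], [b],
   divided by their sum [n]. *)
have avg : (n - a) * q0 + (a - b) * q1 + b * q2
    = n * ((n - a) * (a - b) + (a - b) * b + (n - a) * b).
  by rewrite /q0 /q1 /q2 /qform; ring.
(* Three numbers with sum [n] have second elementary symmetric function at most [n ^+ 2 / 3]; the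
   defect is half the sum of the squared differences, divided by 3. *)
have sq : 2 * (n ^+ 2 - 3 * ((n - a) * (a - b) + (a - b) * b + (n - a) * b))
    = (n - a - (a - b)) ^+ 2 + (a - b - b) ^+ 2 + (n - a - b) ^+ 2.
  by ring.
have ge0 := addr_ge0 (addr_ge0 (sqr_ge0 (n - a - (a - b))) (sqr_ge0 (a - b - b)))
                     (sqr_ge0 (n - a - b)).
rewrite -sq in ge0; move: avg ge0 {sq}.
set t := (X in n * X) => avg ge0.
have k0 : (n - a) * (n ^+ 2 + 1) <= (n - a) * (3 * q0).
  by apply: ler_wpM2l; [lia | rewrite /q0; lia].
have k1 : (a - b) * (n ^+ 2 + 1) <= (a - b) * (3 * q1).
  by apply: ler_wpM2l; [lia | rewrite /q1; lia].
have k2 : b * (n ^+ 2 + 1) <= b * (3 * q2).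
  by apply: ler_wpM2l; [lia | rewrite /q2; lia].
have k3 : n * (3 * t) <= n * n ^+ 2 by apply: ler_wpM2l; lia.
move: k0 k1 k2 k3 avg; clearbody q0 q1 q2 t => *; exfalso; nia.
Qed.

(** After taking remainders the point lies in a rhombus, which a diagonal cuts into two equilateral
    triangles exchanged by the symmetry of [qform]. *)
Lemma hexagonal_reduce (n x y : int) : 0 < n ->
  exists k l : int, 3 * qform (x - n * k) (y - n * l) <= n ^+ 2.
Proof.
move=> n_gt0; pose k := (x %/ n)%Z; pose l := (y %/ n)%Z.
pose u := x - n * k; pose v := y - n * l.
have n_neq0 : n != 0 by lia.
have [u_ge0 u_lt] : 0 <= u /\ u < n.
  have := divz_eq x n; have := modz_ge0 x n_neq0; have := ltz_pmod x n_gt0.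
  by rewrite /u -/k; lia.
have [v_ge0 v_lt] : 0 <= v /\ v < n.
  have := divz_eq y n; have := modz_ge0 y n_neq0; have := ltz_pmod y n_gt0.
  by rewrite /v -/l; lia.
have uk : u - n = x - n * (k + 1) by rewrite /u; ring.
have vl : v - n = y - n * (l + 1) by rewrite /v; ring.
have [vu|uv] := lerP v u.
  have h : 0 <= v <= u by lia.
  case: (triangle_vertex h u_lt); rewrite ?uk ?vl => H.
  - by exists k, l.
  - by exists (k + 1), l.
  - by exists (k + 1), (l + 1).
have h : 0 <= u <= v by lia.
case: (triangle_vertex h v_lt); rewrite ?uk ?vl qformC => H.
- by exists k, l.
- by exists k, (l + 1).
- by exists (k + 1), (l + 1).
Qed.

(** The norm from Q(i, w) is taken through its real subfield Q(sqrt 3), hence the shape u^2 - 3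
    v^2. *)
Lemma gauss_norm_qform (a b : gauss) :
  gauss_norm (qform a b) = (qform (re a) (re b) + qform (im a) (im b)) ^+ 2
    - 3 * (re a * im b - im a * re b) ^+ 2.
Proof. by rewrite /qform /gauss_norm !expr2 !reimE; ring. Qed.

Lemma gauss_norm_ge0 (z : gauss) : 0 <= gauss_norm z.
Proof. by rewrite addr_ge0 ?sqr_ge0. Qed.

Lemma gauss_norm_eq0 (z : gauss) : (gauss_norm z == 0) = (z == 0).
Proof.
rewrite /gauss_norm paddr_eq0 ?sqr_ge0 // !sqrf_eq0.
apply/andP/eqP => [[/eqP z1 /eqP z2]|->]; last by rewrite !reimE.
exact: gaussE.
Qed.

Lemma qform_int_ge0 (a b : int) : 0 <= qform a b.
Proof.
have : 4 * qform a b = (2 * a - b) ^+ 2 + 3 * b ^+ 2 by rewrite /qform; ring.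
have := sqr_ge0 (2 * a - b); have := sqr_ge0 b.
move: (qform a b) ((2 * a - b) ^+ 2) (b ^+ 2) => q u v; lia.
Qed.

Lemma qform_int_eq0 (a b : int) : qform a b = 0 -> a = 0 /\ b = 0.
Proof.
move=> h; have : (2 * a - b) ^+ 2 + 3 * b ^+ 2 = 0.
  by transitivity (4 * qform a b); [rewrite /qform; ring | rewrite h].
have := sqr_ge0 (2 * a - b); have := sqr_ge0 b => h1 h2 h3.
have /eqP : b ^+ 2 = 0 by lia.
have /eqP : (2 * a - b) ^+ 2 = 0 by lia.
by rewrite !sqrf_eq0 => /eqP ? /eqP ?; lia.
Qed.

(** The 3-adic valuations of the two sides have different parities. *)
Lemma sqr_neq_3sqr (u v : int) : u ^+ 2 = 3 * v ^+ 2 -> v = 0.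
Proof.
move=> h; apply/eqP/negPn/negP => v0.
have u0 : u != 0 by rewrite -sqrf_eq0 h mulf_neq0 // sqrf_eq0.
have := congr1 (logn 3 \o absz) h; rewrite /= abszM !abszX.
rewrite lognM ?expn_gt0 ?absz_gt0 ?v0 // !lognX.
by rewrite (_ : logn 3 `|3%:Z| = 1%N) //; lia.
Qed.

Lemma qform_gauss_eq0 (a b : gauss) : qform a b = 0 -> a = 0 /\ b = 0.
Proof.
move=> h; have := gauss_norm_qform a b; rewrite h => /esym/eqP.
rewrite (_ : gauss_norm 0 = 0) // subr_eq0 => /eqP h3.
have v0 := sqr_neq_3sqr h3; move: h3; rewrite v0 => /eqP.
rewrite [_ * _]mulr0 sqrf_eq0 paddr_eq0 ?qform_int_ge0 // => /andP[/eqP h1 /eqP h2].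
have [ra rb] := qform_int_eq0 h1; have [ia ib] := qform_int_eq0 h2.
by split; apply: gaussE.
Qed.

Definition gauss_conj (z : gauss) := Gauss (re z) (- im z).

Lemma gauss_mulCj (z : gauss) : gauss_conj z * z = Gauss (gauss_norm z) 0.
Proof. by apply: gaussE; rewrite /gauss_norm !reimE /=; ring. Qed.

(** Multiplying by the conjugate of [m] makes the modulus the integer [n]; real and imaginary parts
    are then reduced separately to forms at most n^2 / 3. Dropping the term -3 v^2 of
    [gauss_norm_qform] bounds the norm by 4 n^4 / 9, and dividing by n^2 leaves 4 n^2 / 9. *)
Lemma qform_gauss_reduce (m a b : gauss) : m != 0 ->
  exists k l, gauss_norm (qform (a - m * k) (b - m * l)) < gauss_norm m ^+ 2.
Proof.
move=> m_neq0; set n := gauss_norm m.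
have n_gt0 : 0 < n.
  by rewrite Order.POrderTheory.lt_def gauss_norm_eq0 m_neq0 gauss_norm_ge0.
pose x := gauss_conj m * a; pose y := gauss_conj m * b.
have [k0 [l0 h0]] := hexagonal_reduce (re x) (re y) n_gt0.
have [k1 [l1 h1]] := hexagonal_reduce (im x) (im y) n_gt0.
exists (Gauss k0 k1), (Gauss l0 l1).
set a' := a - _; set b' := b - _.
have ea : gauss_conj m * a' = x - Gauss (n * k0) (n * k1).
  rewrite /a' mulrBr mulrA gauss_mulCj -/n.
  by apply: gaussE; rewrite !reimE /=; ring.
have eb : gauss_conj m * b' = y - Gauss (n * l0) (n * l1).
  rewrite /b' mulrBr mulrA gauss_mulCj -/n.
  by apply: gaussE; rewrite !reimE /=; ring.
have ec : gauss_norm (gauss_conj m) = n.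
  by rewrite /n /gauss_norm /= sqrrN.
have := gauss_norm_qform (gauss_conj m * a') (gauss_conj m * b').
have -> : qform (gauss_conj m * a') (gauss_conj m * b')
    = gauss_conj m ^+ 2 * qform a' b' by rewrite /qform; ring.
rewrite expr2 !gauss_normM !ec ea eb !reimE /=.
have := qform_int_ge0 (re x - n * k0) (re y - n * l0).
have := qform_int_ge0 (im x - n * k1) (im y - n * l1).
move: h0 h1; set q0 := qform _ _; set q1 := qform _ _; set t := gauss_norm _.
set V := (X in _ - 3 * X); have : 0 <= V by apply: sqr_ge0.
clearbody q0 q1 V t => V_ge0 h0 h1 q1_ge0 q0_ge0 h.
have hq : 9 * (q0 + q1) ^+ 2 <= 4 * (n ^+ 2) ^+ 2.
  have : (3 * (q0 + q1)) ^+ 2 <= (2 * n ^+ 2) ^+ 2 by rewrite ler_sqr ?nnegrE; lia.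
  by rewrite !exprMn.
have : n ^+ 2 * (9 * t) <= n ^+ 2 * (4 * n ^+ 2) by lia.
by rewrite ler_pM2l ?exprn_gt0 //; have := exprn_gt0 2 n_gt0; lia.
Qed.

(** * Roots of unity modulo p and primes as norms *)

Lemma Fp_prim_root (p d : nat) : prime p -> (d %| p.-1)%N ->
  exists z : 'F_p, d.-primitive_root z.
Proof.
move=> p_pr d_dvd; have p_gt1 := prime_gt1 p_pr.
(* The nonzero elements are [p.-1] distinct roots of unity of order dividing [p.-1], so one of them
   is primitive. *)
pose rs := [seq x <- enum 'F_p | x != 0].
have : has p.-1.-primitive_root rs.
  apply: has_prim_root; rewrite //; first by lia.
    apply/allP => x; rewrite mem_filter unity_rootE => /andP[x_neq0 _].
    apply/eqP/(mulfI x_neq0).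
    rewrite -exprS prednK ?prime_gt0 // mulr1.
    by rewrite -[X in _ ^+ X](card_Fp p_pr) expf_card.
    by apply: filter_uniq; exact: enum_uniq.
  have szp : size (enum 'F_p) = p by rewrite -[RHS](card_Fp p_pr) cardE.
  have := count_predC (pred1 (0 : 'F_p)) (enum 'F_p).
  rewrite szp (count_uniq_mem _ (enum_uniq _)) mem_enum /= /rs size_filter.
  by rewrite (@eq_count _ (fun x => x != 0) (predC (pred1 0))) //; lia.
move=> /hasP[z _ z_prim]; exists (z ^+ (p.-1 %/ d)).
exact: dvdn_prim_root.
Qed.

Lemma dvdz_Fp (p : nat) (n : int) :
  prime p -> (p%:Z %| n)%Z = (n%:~R == 0 :> 'F_p).
Proof. by move=> p_pr; rewrite (dvdz_pcharf (pchar_Fp p_pr)). Qed.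

Lemma dvdz_sqrD1 (p : nat) : prime p -> (p %% 4 = 1)%N ->
  exists s : int, (p%:Z %| s ^+ 2 + 1)%Z.
Proof.
move=> p_pr p1; have d4 : (4 %| p.-1)%N by lia.
have [z z_prim] := Fp_prim_root p_pr d4; exists (z : nat)%:Z.
rewrite dvdz_Fp // rmorphD rmorphXn /= -pmulrn natr_Zp.
have : (z ^+ 2 - 1) * (z ^+ 2 + 1) == 0.
  by rewrite -subr_sqr -exprM (prim_expr_order z_prim) expr1n subrr.
rewrite mulf_eq0 => /orP[|//]; rewrite subr_eq0 => /eqP z2.
by have := prim_order_dvd z_prim 2; rewrite z2 eqxx.
Qed.

(** For a primitive cube root of unity [z] one takes [s = - z], as [qform s 1] is then
    [z ^+ 2 + z + 1]. *)
Lemma dvdz_qform1 (p : nat) : prime p -> (p %% 3 = 1)%N ->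
  exists s : int, (p%:Z %| qform s 1)%Z.
Proof.
move=> p_pr p1; have d3 : (3 %| p.-1)%N by lia.
have [z z_prim] := Fp_prim_root p_pr d3; exists (- (z : nat)%:Z).
rewrite dvdz_Fp // /qform mulr1 expr1n opprK sqrrN.
rewrite !rmorphD rmorphXn rmorph1 /= -pmulrn natr_Zp.
have : (z - 1) * (z ^+ 2 + z + 1) == 0.
  apply/eqP; transitivity (z ^+ 3 - 1); first by ring.
  by rewrite (prim_expr_order z_prim) subrr.
rewrite mulf_eq0 => /orP[|]; last by [].
rewrite subr_eq0 => /eqP z1.
by have := prim_order_dvd z_prim 1; rewrite z1 expr1 eqxx.
Qed.

Lemma prime_sum_two_squares (p : nat) : prime p -> (p %% 4 = 1)%N ->
  exists a b : int, p%:Z = a ^+ 2 + b ^+ 2.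
Proof.
move=> p_pr p1; have [s /dvdzP[k hk]] := dvdz_sqrD1 p_pr p1.
have [|||a [b]] := @form_represents_prime _ absz (0 : int) abszM absz_eq0 _ _
    p%:Z s k p_pr.
- move=> a b; rewrite /form !mul0r subr0 => /eqP.
  by rewrite paddr_eq0 ?sqr_ge0 // !sqrf_eq0 => /andP[/eqP-> /eqP->].
- move=> m a b m_neq0.
  have [i hi] := int_reduce a m_neq0; have [j hj] := int_reduce b m_neq0.
  exists i, j; rewrite /form !mul0r subr0 -abszX.
  have : 0 < m ^+ 2 by rewrite exprn_even_gt0 // m_neq0.
  have := sqr_ge0 (a - m * i); have := sqr_ge0 (b - m * j).
  by move: hi hj; move: (m ^+ 2) ((a - _) ^+ 2) ((b - _) ^+ 2) => *; lia.
- by rewrite /form !mul0r subr0 expr1n hk mulrC.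
rewrite /form !mul0r subr0 => h; exists a, b.
by have := sqr_ge0 a; have := sqr_ge0 b; move: h; move: (a ^+ 2) (b ^+ 2); lia.
Qed.

Lemma form1_qform (R : comNzRingType) (a b : R) : form 1 a b = qform a b.
Proof. by rewrite /form mul1r. Qed.

Lemma prime_qform (p : nat) : prime p -> (p %% 3 = 1)%N ->
  exists a b : int, p%:Z = qform a b.
Proof.
move=> p_pr p1; have [s /dvdzP[k hk]] := dvdz_qform1 p_pr p1.
have [|||a [b]] := @form_represents_prime _ absz (1 : int) abszM absz_eq0 _ _
    p%:Z s k p_pr.
- by move=> a b; rewrite form1_qform; apply: qform_int_eq0.
- move=> m a b m_neq0; have m_gt0 : 0 < `|m| by rewrite normr_gt0.
  have [i [j h]] := hexagonal_reduce a b m_gt0.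
  have [e em] : exists e : int, `|m| = m * e.
    by case: (ger0P m) => _; [exists 1 | exists (-1)]; rewrite ?mulr1 ?mulrN1.
  exists (e * i), (e * j); rewrite form1_qform -abszX !mulrA -em.
  have := qform_int_ge0 (a - `|m| * i) (b - `|m| * j).
  have : 0 < m ^+ 2 by rewrite exprn_even_gt0 // m_neq0.
  by move: h; rewrite real_normK ?num_real //; move: (m ^+ 2) (qform _ _); lia.
- by rewrite form1_qform hk mulrC.
by rewrite form1_qform => h; exists a, b; have := qform_int_ge0 a b; lia.
Qed.

(** The descent runs over Z[i], for a Gaussian prime [Gauss c d] above [p], whose own norm is [p];
    it divides [qform s 1] because [p] does. *)
Lemma prime_gauss_qform (p : nat) : prime p -> (p %% 12 = 1)%N ->
  exists a b : gauss, p%:Z = gauss_norm (qform a b).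
Proof.
move=> p_pr p1.
have [s /dvdzP[k hk]] : exists s : int, (p%:Z %| qform s 1)%Z.
  by apply: dvdz_qform1 => //; lia.
have [c [d hcd]] : exists a b : int, p%:Z = a ^+ 2 + b ^+ 2.
  by apply: prime_sum_two_squares => //; lia.
pose N z := `|gauss_norm z|%N.
have N_prime : prime (N (Gauss c d)) by rewrite /N /gauss_norm /= -hcd.
have NM : {morph N : x y / x * y >-> (x * y)%N}.
  by move=> x y; rewrite /N gauss_normM abszM.
have N_eq0 z : (N z == 0%N) = (z == 0) by rewrite /N absz_eq0 gauss_norm_eq0.
have [|||a [b]] := @form_represents_prime _ N (1 : gauss) NM N_eq0 _ _
    (Gauss c d) (Gauss s 0) (gauss_conj (Gauss c d) * Gauss k 0) N_prime.
- by move=> a b; rewrite form1_qform; apply: qform_gauss_eq0.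
- move=> m a b m_neq0; have [i [j h]] := qform_gauss_reduce a b m_neq0.
  exists i, j; rewrite form1_qform /N -abszX.
  move: (gauss_norm_ge0 (qform (a - m * i) (b - m * j))) h.
  by move: (gauss_norm (qform _ _)) (gauss_norm m ^+ 2) => *; lia.
- rewrite form1_qform mulrA [_ * gauss_conj _]mulrC gauss_mulCj.
  have -> : gauss_norm (Gauss c d) = p%:Z by rewrite /gauss_norm /= -hcd.
  transitivity (Gauss (qform s 1) 0); last first.
    by rewrite hk; apply: gaussE; rewrite !reimE /=; ring.
  by apply: gaussE; rewrite /qform !expr2 !reimE /=; ring.
rewrite form1_qform /N => h; exists a, b.
have -> : p%:Z = gauss_norm (Gauss c d) by rewrite /gauss_norm /= -hcd.
by have := gauss_norm_ge0 (qform a b); have := gauss_norm_ge0 (Gauss c d); lia.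
Qed.

(** * Primes dividing norms *)

Section ElevenModTwelve.

Variables (p : nat) (p_pr : prime p) (p11 : (p %% 12 = 11)%N).

Let Fp_natr_neq0 (n : nat) : (0 < n < 11)%N -> n%:R != 0 :> 'F_p.
Proof.
move=> n_bd; rewrite -(dvdn_pcharf (pchar_Fp p_pr)).
by apply/negP => /dvdn_leq; lia.
Qed.

(** Frobenius fixes [z], and [p] is 11 modulo 12. *)
Let Fp_expr11 (z : 'F_p) : z ^+ 12 = 1 -> z ^+ 11 = z.
Proof.
move=> z12; rewrite -[RHS]expf_card card_Fp //.
transitivity (z ^+ (12 * (p %/ 12) + 11)).
  by rewrite exprD exprM z12 expr1n mul1r.
by congr (_ ^+ _); lia.
Qed.

Lemma dvdz_sum_two_squares (a b : int) :
  (p%:Z %| a ^+ 2 + b ^+ 2)%Z -> (p%:Z %| a)%Z && (p%:Z %| b)%Z.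
Proof.
rewrite !dvdz_Fp // rmorphD !rmorphXn /=.
set x : 'F_p := a%:~R; set y : 'F_p := b%:~R => /eqP xy.
have y0 : y == 0.
  apply/negPn/negP => y_neq0; pose z := x / y.
  (* A square root of -1 has 11th power [- z]; comparison with [Fp_expr11] gives [2 z = 0]. *)
  have z2 : z ^+ 2 = -1.
    apply: (mulIf (expf_neq0 2 y_neq0)); rewrite -exprMn divfK // mulN1r.
    by apply/eqP; rewrite -addr_eq0 xy.
  have /Fp_expr11 : z ^+ 12 = 1 by rewrite (exprM z 2 6) z2; ring.
  have -> : z ^+ 11 = - z by rewrite (exprD z 10 1) (exprM z 2 5) z2; ring.
  move=> /eqP; rewrite eq_sym -subr_eq0 opprK -mulr2n -mulr_natr mulf_eq0.
  rewrite (negPf (Fp_natr_neq0 _)) // orbF => /eqP z0; move: z2.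
  by rewrite z0 expr0n => /esym/eqP; rewrite oppr_eq0 oner_eq0.
move: xy; rewrite (eqP y0) expr0n addr0 => /eqP.
by rewrite sqrf_eq0 => ->; rewrite eqxx.
Qed.

Lemma dvdz_qform (a b : int) :
  (p%:Z %| qform a b)%Z -> (p%:Z %| a)%Z && (p%:Z %| b)%Z.
Proof.
rewrite /qform !dvdz_Fp // rmorphD rmorphB !rmorphXn rmorphM /=.
set x : 'F_p := a%:~R; set y : 'F_p := b%:~R => /eqP xy.
have y0 : y == 0.
  apply/negPn/negP => y_neq0; pose z := x / y.
  (* A root of X^2 - X + 1 has as 11th power its inverse [1 - z]; comparison with [Fp_expr11] gives
     [2 z = 1], and then 3 = 0. *)
  have z2 : z ^+ 2 = z - 1.
    apply: (mulIf (expf_neq0 2 y_neq0)); rewrite -exprMn divfK //.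
    apply/eqP; rewrite -subr_eq0 -xy /z; apply/eqP; field.
    exact: y_neq0.
  have z3 : z ^+ 3 = -1 by rewrite exprS z2; ring: z2.
  have /Fp_expr11 : z ^+ 12 = 1 by rewrite (exprM z 3 4) z3; ring.
  have -> : z ^+ 11 = 1 - z by rewrite (exprD z 9 2) (exprM z 3 3) z3; ring: z2.
  move=> /eqP; rewrite subr_eq -mulr2n => /eqP z_half.
  have : 3%:R == 0 :> 'F_p.
    apply/eqP; transitivity (4%:R * (z ^+ 2 - (z - 1)) - (z *+ 2 - 1) ^+ 2).
      by ring.
    by rewrite z2 -z_half !subrr mulr0 expr0n subr0.
  by rewrite (negPf (Fp_natr_neq0 _)).
move: xy; rewrite (eqP y0) mulr0 subr0 expr0n addr0 => /eqP.
by rewrite sqrf_eq0 => ->; rewrite eqxx.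
Qed.

End ElevenModTwelve.

Lemma modn12_primes1 (n : nat) : (0 < n)%N ->
  (forall p, prime p -> (p %| n)%N -> (p %% 12 = 1)%N) -> (n %% 12 = 1)%N.
Proof.
elim/ltn_ind: n => n IH n_gt0 h.
have [n1|n1] := leqP n 1; first by rewrite (_ : n = 1%N) //; lia.
have p_pr := pdiv_prime n1; have p_dvd := pdiv_dvd n.
set p := pdiv n in p_pr p_dvd; have p1 := h p p_pr p_dvd.
have := divnK p_dvd; set m := (n %/ p)%N => nE.
have m_gt0 : (0 < m)%N by case: (posnP m) nE => // ->; lia.
have m1 : (m %% 12 = 1)%N.
  apply: IH => //; first by rewrite -nE ltn_Pmulr // prime_gt1.
  by move=> q q_pr q_dvd; apply: h => //; rewrite -nE dvdn_mulr.
by rewrite -nE -modnMm m1 p1.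
Qed.

(** A prime that is 11 modulo 12 is inert in Z[w], so it divides both arguments and splits off as a
    square, which is 1 modulo 4. What remains is positive with all prime factors 1 modulo 12. *)
Lemma qform_mod4 (a b : int) : qform a b != 0 ->
  (forall p, prime p -> (p%:Z %| qform a b)%Z ->
     (p %% 12 = 1)%N \/ (p %% 12 = 11)%N) ->
  (qform a b %% 4)%Z = 1.
Proof.
move: {2}`|qform a b|%N (erefl `|qform a b|%N) => n.
elim/ltn_ind: n a b => n IH a b nE q_neq0 h.
have q_ge0 := qform_int_ge0 a b.
have [[p [p_pr p11 p_dvd]]|no11] := classic (exists p,
    [/\ prime p, (p %% 12 = 11)%N & (p%:Z %| qform a b)%Z]).
  have /andP[/dvdzP[c cE] /dvdzP[d dE]] := dvdz_qform p_pr p11 p_dvd.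
  have qE : qform a b = p%:Z ^+ 2 * qform c d by rewrite cE dE /qform; ring.
  have cd_neq0 : qform c d != 0 by move: q_neq0; rewrite qE mulf_eq0 negb_or => /andP[].
  have p_gt1 := prime_gt1 p_pr.
  have : (qform c d %% 4)%Z = 1.
    apply: (IH _ _ c d erefl) => //.
      rewrite -nE qE abszM ltn_Pmull ?absz_gt0 // abszX.
      by rewrite (leq_trans p_gt1) // leq_pmulr //; lia.
    by move=> r r_pr r_dvd; apply: h => //; rewrite qE dvdz_mull.
  rewrite qE -modzMm => ->; rewrite mulr1 modz_mod.
  have [k kE] : exists k : nat, p = (12 * k + 11)%N by exists (p %/ 12)%N; lia.
  rewrite kE; have -> : (12 * k + 11)%N%:Z ^+ 2
    = 4 * (36 * k%:Z ^+ 2 + 66 * k%:Z + 30) + 1 by rewrite PoszD PoszM; ring.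
  by lia.
have : (`|qform a b| %% 12 = 1)%N.
  apply: modn12_primes1; first by rewrite absz_gt0.
  move=> p p_pr p_dvd; case: (h p p_pr) => // p11.
  by case: no11; exists p.
by move: q_ge0; move: (qform a b) => q; lia.
Qed.

Lemma gauss_norm_conj (z : gauss) : gauss_norm (gauss_conj z) = gauss_norm z.
Proof. by rewrite /gauss_norm /= sqrrN. Qed.

Lemma gauss_conjK : involutive gauss_conj.
Proof. by move=> z; apply: gaussE; rewrite /= ?opprK. Qed.

(** The norm hypothesis carries divisibility by [p] from the real part of [gauss_conj pi * z] to its
    imaginary part; then [p = pi * gauss_conj pi] is cancelled down to [pi]. *)
Lemma gauss_prime_factor (p : nat) (pi z : gauss) : prime p ->
  gauss_norm pi = p%:Z -> (p%:Z %| gauss_norm z)%Z ->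
  (p%:Z %| re (gauss_conj pi * z))%Z -> exists w, z = pi * w.
Proof.
move=> p_pr pi_norm p_dvd /dvdzP[u uE].
have p_neq0 : p%:Z != 0 by have := prime_gt0 p_pr; lia.
have /dvdzP[v vE] : (p%:Z %| im (gauss_conj pi * z))%Z.
  have : (p%:Z %| im (gauss_conj pi * z) ^+ 2)%Z.
    have -> : im (gauss_conj pi * z) ^+ 2
        = gauss_norm (gauss_conj pi * z) - re (gauss_conj pi * z) ^+ 2.
      by rewrite /gauss_norm addrC addKr.
    apply: rpredB; first by rewrite gauss_normM dvdz_mull.
    by rewrite uE dvdz_exp // dvdz_mull.
  by rewrite !dvdzE abszX Euclid_dvdX // => /andP[].
exists (Gauss u v).
have e : Gauss p%:Z 0 * z = Gauss p%:Z 0 * (pi * Gauss u v).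
  have cz : gauss_conj pi * z = Gauss p%:Z 0 * Gauss u v.
    by apply: gaussE; rewrite ?uE ?vE !reimE /=; ring.
  transitivity (pi * (gauss_conj pi * z)); last by rewrite cz; ring.
  by rewrite -pi_norm -gauss_mulCj; ring.
apply: gaussE; apply: (mulfI p_neq0).
  by have := congr1 re e; rewrite ![re (Gauss p%:Z 0 * _)]reM /= !mul0r !subr0.
by have := congr1 im e; rewrite ![im (Gauss p%:Z 0 * _)]imM /= !mul0r !addr0.
Qed.

Lemma gauss_prime_divisor (p : nat) (pi z : gauss) : prime p ->
  gauss_norm pi = p%:Z -> (p%:Z %| gauss_norm z)%Z ->
  exists w, z = pi * w \/ z = gauss_conj pi * w.
Proof.
move=> p_pr pi_norm p_dvd.
have : (p%:Z %| re (gauss_conj pi * z) * re (pi * z))%Z.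
  have -> : re (gauss_conj pi * z) * re (pi * z)
      = re pi ^+ 2 * gauss_norm z - im z ^+ 2 * gauss_norm pi.
    by rewrite /gauss_norm !reimE /=; ring.
  by apply: rpredB; rewrite dvdz_mull // pi_norm.
rewrite dvdzE abszM Euclid_dvdM // => /orP[] p_dvd'.
  by have [w ->] := gauss_prime_factor p_pr pi_norm p_dvd p_dvd'; exists w; left.
have [|//|w ->] := @gauss_prime_factor p (gauss_conj pi) z p_pr _ p_dvd.
- by rewrite gauss_norm_conj.
- by rewrite gauss_conjK.
by exists w; right.
Qed.

(* [z] is congruent modulo 6 to an integer or to [i] times an integer. *)
Definition axis6 (z : gauss) : bool := (6 %| re z)%Z || (6 %| im z)%Z.

Lemma axis6M (z w : gauss) : axis6 z -> axis6 w -> axis6 (z * w).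
Proof.
rewrite /axis6 !reimE => /orP[] hz /orP[] hw; apply/orP.
- by right; rewrite rpredD ?(dvdz_mull _ hw) ?(dvdz_mulr _ hz).
- by left; rewrite rpredB ?(dvdz_mull _ hw) ?(dvdz_mulr _ hz).
- by left; rewrite rpredB ?(dvdz_mull _ hw) ?(dvdz_mulr _ hz).
- by right; rewrite rpredD ?(dvdz_mull _ hw) ?(dvdz_mulr _ hz).
Qed.

Lemma axis6_conj (z : gauss) : axis6 (gauss_conj z) = axis6 z.
Proof. by rewrite /axis6 /= !dvdzE abszN. Qed.

Lemma sum_two_squares_eq1 (x y : int) : x ^+ 2 + y ^+ 2 = 1 ->
  (x = 0 /\ (y = 1 \/ y = -1)) \/ (y = 0 /\ (x = 1 \/ x = -1)).
Proof.
move=> h; have hx := sqr_ge0 x; have hy := sqr_ge0 y.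
have x_bd : x ^+ 2 <= 1 by lia.
have y_bd : y ^+ 2 <= 1 by lia.
have [x1 x2] : -1 <= x /\ x <= 1 by clear -x_bd; split; nia.
have [y1 y2] : -1 <= y /\ y <= 1 by clear -y_bd; split; nia.
have dx : x = 0 \/ x = 1 \/ x = -1 by lia.
have dy : y = 0 \/ y = 1 \/ y = -1 by lia.
by move: h; case: dx => [->|[->|->]]; case: dy => [->|[->|->]] //; tauto.
Qed.

(** The representation of [p] as a sum of two squares is unique up to units and conjugation, and
    these preserve [axis6]. Conversely, two nonzero residues modulo 6 with sum of squares 1 modulo
    12 are 3 and 2 or 4, in some order. *)
Lemma P1_primeP (p : nat) (z : gauss) :
  prime p -> (p %% 12 = 1)%N -> gauss_norm z = p%:Z ->
  P1_prime p <-> ~~ axis6 z.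
Proof.
move=> p_pr p1; case: z => c d; rewrite /gauss_norm /= => zE; split.
  move=> [_ _ [k [t pE]]]; apply/negP => ax.
  pose pi := Gauss (6 * k + 2) (6 * t + 3).
  have pi_norm : gauss_norm pi = p%:Z by rewrite /gauss_norm /= -pE.
  have [|w hw] := @gauss_prime_divisor p pi (Gauss c d) p_pr pi_norm.
    by rewrite /gauss_norm /= zE.
  have w1 : gauss_norm w = 1.
    have p_neq0 : p%:Z != 0 by have := prime_gt0 p_pr; lia.
    apply: (mulfI p_neq0); rewrite mulr1 -[in RHS]zE -[RHS]/(gauss_norm (Gauss c d)).
    by case: hw => ->; rewrite gauss_normM ?gauss_norm_conj pi_norm.
  have {w1} : (re w = 0 /\ (im w = 1 \/ im w = -1))
      \/ (im w = 0 /\ (re w = 1 \/ re w = -1)).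
    exact: sum_two_squares_eq1.
  move: hw ax; case: w => x y /= [] ->; rewrite /axis6 !reimE /=.
    by move=> + [[xE [yE|yE]]|[yE [xE|xE]]]; rewrite xE yE; lia.
  by move=> + [[xE [yE|yE]]|[yE [xE|xE]]]; rewrite xE yE; lia.
rewrite /axis6 /= negb_or => /andP[hc hd]; split=> //.
have [q [r [cE r_bd]]] : exists q r : int, c = 6 * q + r /\ 0 <= r < 6.
  by exists (c %/ 6)%Z, (c %% 6)%Z; lia.
have [u [s [dE s_bd]]] : exists u s : int, d = 6 * u + s /\ 0 <= s < 6.
  by exists (d %/ 6)%Z, (d %% 6)%Z; lia.
(* The square of an integer modulo 12 depends only on its residue modulo 6. *)
have rs : ((r ^+ 2 + s ^+ 2) %% 12)%Z = 1.
  have pE : p%:Z = 12 * (3 * q ^+ 2 + q * r + 3 * u ^+ 2 + u * s)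
      + (r ^+ 2 + s ^+ 2) by rewrite -zE cE dE; ring.
  by move: pE; move: (3 * q ^+ 2 + _ + _ + _) (r ^+ 2 + s ^+ 2) => *; lia.
have {rs r_bd s_bd} : [\/ r = 2 /\ s = 3, r = 4 /\ s = 3, r = 3 /\ s = 2
    | r = 3 /\ s = 4].
  have hr : r != 0 by apply: contraNneq hc => r0; rewrite cE r0; lia.
  have hs : s != 0 by apply: contraNneq hd => s0; rewrite dE s0; lia.
  have dr : [|| r == 1, r == 2, r == 3, r == 4 | r == 5] by lia.
  have ds : [|| s == 1, s == 2, s == 3, s == 4 | s == 5] by lia.
  case/or4P: dr => [/eqP rE|/eqP rE|/eqP rE|/orP[]/eqP rE];
  case/or4P: ds => [/eqP sE|/eqP sE|/eqP sE|/orP[]/eqP sE];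
  move/eqP: rs; rewrite rE sE => // _;
  by [constructor 1 | constructor 2 | constructor 3 | constructor 4].
case=> [[rE sE]|[rE sE]|[rE sE]|[rE sE]]; subst r s.
- by exists q, u; rewrite -zE cE dE.
(* The residue 4 is -2, so the sign of that coordinate is changed. *)
- by exists (- q - 1), u; rewrite -zE cE dE; ring.
- by exists u, q; rewrite -zE cE dE; ring.
- by exists (- u - 1), q; rewrite -zE cE dE; ring.
Qed.

Lemma prime_coprime6_mod12 (p : nat) : prime p -> p != 2 -> p != 3 ->
  [\/ (p %% 12 = 1)%N, (p %% 12 = 5)%N, (p %% 12 = 7)%N | (p %% 12 = 11)%N].
Proof.
move=> p_pr p2 p3.
have h2 : ~~ (2 %| p)%N by rewrite dvdn_prime2 // eq_sym.
have h3 : ~~ (3 %| p)%N by rewrite dvdn_prime2 // eq_sym.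
by have /or4P[] : [|| p %% 12 == 1, p %% 12 == 5, p %% 12 == 7 | p %% 12 == 11]%N;
  [lia | move/eqP; constructor..].
Qed.

Lemma not_admissible_mod12 (p : nat) : prime p -> p != 2 -> p != 3 ->
  ~ admissible_prime p -> (p %% 12 = 1)%N \/ (p %% 12 = 11)%N.
Proof.
move=> p_pr p2 p3 p_adm.
case: (prime_coprime6_mod12 p_pr p2 p3); [by left | | | by right].
  by move=> p5; case: p_adm; constructor 1.
by move=> p7; case: p_adm; constructor 2.
Qed.

(** The prime factors of such an integer are 11 modulo 12, or 1 modulo 12 and outside P_1. *)
Definition free_of_admissible (n : int) : Prop :=
  [/\ ~~ (2 %| n)%Z, ~~ (3 %| n)%Z
    & forall p, admissible_prime p -> ~~ (p%:Z %| n)%Z].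

Lemma free_of_admissible_dvd (m n : int) :
  (m %| n)%Z -> free_of_admissible n -> free_of_admissible m.
Proof.
move=> mn [h2 h3 h]; split.
- by apply: contra h2 => /dvdz_trans; apply.
- by apply: contra h3 => /dvdz_trans; apply.
by move=> p /h; apply: contra => /dvdz_trans; apply.
Qed.

Lemma free_of_admissible_prime (p : nat) (n : int) :
  free_of_admissible n -> prime p -> (p%:Z %| n)%Z ->
  ~ P1_prime p /\ ((p %% 12 = 1)%N \/ (p %% 12 = 11)%N).
Proof.
move=> [h2 h3 h] p_pr p_dvd.
have p_adm : ~ admissible_prime p by move/h; rewrite p_dvd.
split; first by move=> P1; case: p_adm; constructor 3.
apply: not_admissible_mod12 => //.
  by apply: contraNneq h2 => pE; move: p_dvd; rewrite pE.
by apply: contraNneq h3 => pE; move: p_dvd; rewrite pE.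
Qed.

Lemma qform_free_mod4 (a b : int) :
  free_of_admissible (qform a b) -> (qform a b %% 4)%Z = 1.
Proof.
move=> h; apply: qform_mod4.
  by case: h => h2 _ _; apply: contraNneq h2 => ->.
by move=> p p_pr p_dvd; have [] := free_of_admissible_prime h p_pr p_dvd.
Qed.

(** Factor [z] in Z[i]: primes that are 11 modulo 12 are inert and contribute integers, those that
    are 1 modulo 12 lie on the axes by [P1_primeP], and so do the units; [axis6] is
    multiplicative. *)
Lemma gauss_free_axis6 (z : gauss) :
  free_of_admissible (gauss_norm z) -> axis6 z.
Proof.
move: {2}`|gauss_norm z|%N (erefl `|gauss_norm z|%N) => n.
elim/ltn_ind: n z => n IH z nE h.
have norm_gt0 : 0 < gauss_norm z.
  rewrite Order.POrderTheory.lt_def gauss_norm_ge0 andbT.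
  by case: h => h2 _ _; apply: contraNneq h2 => ->.
have n_gt0 : (0 < n)%N by rewrite -nE absz_gt0; lia.
have [n1|n_gt1] := leqP n 1.
  have /orP[/eqP z0|/eqP z0] : (re z == 0) || (im z == 0).
    have norm1 : gauss_norm z = 1 by lia.
    by case: (sum_two_squares_eq1 norm1) => -[-> _]; rewrite eqxx ?orbT.
  - by rewrite /axis6 z0.
  - by rewrite /axis6 z0 orbT.
have p_pr := pdiv_prime n_gt1.
have p_dvd : ((pdiv n)%:Z %| gauss_norm z)%Z by rewrite dvdzE /= nE pdiv_dvd.
move: (pdiv n) p_pr p_dvd => p p_pr p_dvd.
have [notP1 mod12] := free_of_admissible_prime h p_pr p_dvd.
have step (x w : gauss) : z = x * w -> (1 < `|gauss_norm x|)%N -> axis6 x ->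
    axis6 z.
  move=> zE x_gt1 x_ax; rewrite zE axis6M //.
  have normE : gauss_norm z = gauss_norm x * gauss_norm w.
    by rewrite zE gauss_normM.
  apply: (IH _ _ w erefl).
    rewrite -nE normE abszM; move: n_gt0; rewrite -nE normE abszM; nia.
  by apply: free_of_admissible_dvd h; rewrite normE dvdz_mull.
have p_gt1 := prime_gt1 p_pr.
case: mod12 => [p1|p11]; last first.
  have /andP[/dvdzP[c cE] /dvdzP[d dE]] := dvdz_sum_two_squares p_pr p11 p_dvd.
  apply: (step (Gauss p%:Z 0) (Gauss c d)); last by rewrite /axis6 orbT.
    by apply: gaussE; rewrite !reimE /= ?cE ?dE; ring.
  have -> : gauss_norm (Gauss p%:Z 0) = p%:Z ^+ 2 by rewrite /gauss_norm /=; ring.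
  by rewrite abszX; nia.
have [|a [b abE]] := @prime_sum_two_squares p p_pr; first by lia.
have pi_norm : gauss_norm (Gauss a b) = p%:Z by rewrite /gauss_norm /= -abE.
have pi_ax : axis6 (Gauss a b).
  by apply/negPn/negP => /(P1_primeP p_pr p1 pi_norm).
have [w [zE|zE]] := gauss_prime_divisor p_pr pi_norm p_dvd.
  by apply: step zE _ pi_ax; rewrite pi_norm.
by apply: step zE _ _; rewrite ?axis6_conj // gauss_norm_conj pi_norm.
Qed.

(** * Necessary conditions *)

Lemma dvd2M (x y : int) : (2 %| x * y)%Z = (2 %| x)%Z || (2 %| y)%Z.
Proof. by rewrite !dvdzE abszM Euclid_dvdM. Qed.

Lemma dvd3M (x y : int) : (3 %| x * y)%Z = (3 %| x)%Z || (3 %| y)%Z.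
Proof. by rewrite !dvdzE abszM Euclid_dvdM. Qed.

Lemma dvd2_gauss_norm (z : gauss) :
  (2 %| gauss_norm z)%Z = (2 %| re z + im z)%Z.
Proof.
rewrite -[RHS]orbb -dvd2M /gauss_norm; case: z => x y /=.
have -> : (x + y) * (x + y) = x ^+ 2 + y ^+ 2 + 2 * (x * y) by ring.
by move: (x ^+ 2 + y ^+ 2) (x * y) => *; lia.
Qed.

Lemma gauss_div_1i (z : gauss) : (2 %| gauss_norm z)%Z ->
  exists w, z = Gauss 1 1 * w.
Proof.
rewrite dvd2_gauss_norm; case: z => x y /= xy.
exists (Gauss ((x + y) %/ 2)%Z ((y - x) %/ 2)%Z).
by apply: gaussE; rewrite !reimE /=; lia.
Qed.

Lemma glued_dvd2 (u v : int) (z : gauss) : glued u v z ->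
  (2 %| gauss_norm z)%Z = (2 %| u)%Z /\ (2 %| v)%Z = (2 %| u)%Z.
Proof.
by rewrite gluedP dvd2_gauss_norm; case: z => x y /= /andP[g1 g2]; split; lia.
Qed.

Lemma glued_half (u v : int) (z : gauss) : glued u v z ->
  (2 %| u * v * gauss_norm z)%Z ->
  exists u' v' : int, [/\ u = 2 * u', v = 2 * v',
    (2 %| u' + v' - re z)%Z & (2 %| u' - v' - im z)%Z].
Proof.
move=> g; have [e1 e2] := glued_dvd2 g.
rewrite !dvd2M e1 e2 !orbb => u_even.
move: g; rewrite gluedP; case: z {e1} => x y /= /andP[g1 g2].
by exists (u %/ 2)%Z, (v %/ 2)%Z; split; lia.
Qed.

(** Halving [u] and [v] gives a factor 4. Either [u' + v'] is even and 2 divides [z], or [u' * v']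
    is even and [z] has two odd coordinates, hence an even norm; both give another factor 4. *)
Lemma glued_even16 (u v : int) (z : gauss) : glued u v z ->
  (2 %| u * v * gauss_norm z)%Z -> (16 %| u * v * gauss_norm z)%Z.
Proof.
move=> g h; have [u' [v' [-> -> x_par y_par]]] := glued_half g h.
case: z {g h} x_par y_par => x y /= x_par y_par; rewrite /gauss_norm /=.
have [even|odd] := boolP (2 %| u' + v')%Z.
  have [x' xE] : exists x', x = 2 * x' by exists (x %/ 2)%Z; lia.
  have [y' yE] : exists y', y = 2 * y' by exists (y %/ 2)%Z; lia.
  by apply/dvdzP; exists (u' * v' * (x' ^+ 2 + y' ^+ 2)); rewrite xE yE; ring.
have /dvdzP[t tE] : (2 %| u' * v')%Z by rewrite dvd2M; lia.
have /dvdzP[y' yE] : (2 %| y - x)%Z by lia.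
apply/dvdzP; exists (t * (x ^+ 2 + 2 * x * y' + 2 * y' ^+ 2)).
transitivity (4 * (u' * v') * (x ^+ 2 + (x + (y - x)) ^+ 2)); first by ring.
by rewrite tE yE; ring.
Qed.

(** The odd part of [z] is isolated up to an integer multiple of 1 + i: [c = 2] if [u'] and [v']
    have the same parity (both are then odd), and [c = 1] otherwise. *)
Lemma glued_exactly32 (u v m : int) (z : gauss) : glued u v z ->
  u * v * gauss_norm z = 32 * m -> ~~ (2 %| m)%Z ->
  exists (c : int) (w : gauss),
    z = Gauss c c * w /\ ~~ (2 %| gauss_norm w)%Z.
Proof.
move=> g h m_odd.
have [|u' [v' [uE vE x_par y_par]]] := glued_half g; first by rewrite h; lia.
have norm1i w : gauss_norm (Gauss 1 1 * w) = 2 * gauss_norm w.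
  by rewrite gauss_normM.
case: z {g} h x_par y_par => x y h /= x_par y_par.
have [even|odd] := boolP (2 %| u' + v')%Z.
  pose z' := Gauss (x %/ 2)%Z (y %/ 2)%Z.
  have zE : Gauss x y = Gauss 2 0 * z' by apply: gaussE; rewrite !reimE /=; lia.
  have normE : gauss_norm (Gauss x y) = 4 * gauss_norm z'.
    by rewrite zE gauss_normM.
  have hz : u' * v' * gauss_norm z' = 2 * m.
    apply: (mulfI (isT : 16 != 0 :> int)).
    transitivity (u * v * gauss_norm (Gauss x y)); last by rewrite h; ring.
    by rewrite normE uE vE; ring.
  have uv_odd : ~~ (2 %| u')%Z && ~~ (2 %| v')%Z.
    rewrite -negb_or; apply: contra m_odd => uv.
    have /dvdzP[k uk] : (2 %| u')%Z by lia.
    have /dvdzP[l vl] : (2 %| v')%Z by lia.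
    apply/dvdzP; exists (k * l * gauss_norm z').
    apply: (mulfI (isT : 2 != 0 :> int)); rewrite -hz uk vl; ring.
  have [w wE] : exists w, z' = Gauss 1 1 * w.
    apply: gauss_div_1i; have : (2 %| u' * v' * gauss_norm z')%Z by rewrite hz; lia.
    by rewrite !dvd2M; case/andP: uv_odd => /negPf-> /negPf->.
  exists 2, w; split; first by rewrite zE wE mulrA.
  apply: contra m_odd => w_even.
  have -> : m = u' * v' * gauss_norm w.
    by apply: (mulfI (isT : 2 != 0 :> int)); rewrite -hz wE norm1i; ring.
  by rewrite dvd2M w_even orbT.
have z_even : (2 %| gauss_norm (Gauss x y))%Z by rewrite dvd2_gauss_norm /=; lia.
have [w wE] := gauss_div_1i z_even; exists 1, w; split=> //.
rewrite dvd2_gauss_norm.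
have := congr1 re wE; have := congr1 im wE; rewrite !reimE /= => e1 e2.
by lia.
Qed.

(** As 2 is inert in Z[w], an even form has even arguments; by gluing this holds at -1 too, and 1 +
    i divides [a] and [b]. Each of the three factors then yields 4. *)
Lemma glued_qform_even64 (a1 am : int) (a : gauss) (b1 bm : int) (b : gauss) :
  glued a1 am a -> glued b1 bm b ->
  (2 %| qform a1 b1 * qform am bm * gauss_norm (qform a b))%Z ->
  (64 %| qform a1 b1 * qform am bm * gauss_norm (qform a b))%Z.
Proof.
move=> ga gb; have [e1 e2] := glued_dvd2 (glued_qform ga gb).
rewrite !dvd2M e1 e2 !orbb => q_even.
have [a1_even b1_even] : (2 %| a1)%Z /\ (2 %| b1)%Z.
  have : (2 %| a1 * a1 - a1 * b1 + b1 * b1)%Z by rewrite -!expr2.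
  have := dvd2M a1 a1; have := dvd2M a1 b1; have := dvd2M b1 b1.
  by move: (a1 * a1) (a1 * b1) (b1 * b1) => *; lia.
have [ea eam] := glued_dvd2 ga; have [eb ebm] := glued_dvd2 gb.
have [a' ->] : exists w, a = Gauss 1 1 * w by apply: gauss_div_1i; rewrite ea.
have [b' ->] : exists w, b = Gauss 1 1 * w by apply: gauss_div_1i; rewrite eb.
case/dvdzP: a1_even => k1 kE1; case/dvdzP: b1_even => l1 lE1.
have /dvdzP[km kEm] : (2 %| am)%Z by rewrite eam kE1 dvdz_mull.
have /dvdzP[lm lEm] : (2 %| bm)%Z by rewrite ebm lE1 dvdz_mull.
have -> : qform (Gauss 1 1 * a') (Gauss 1 1 * b') = Gauss 0 2 * qform a' b'.
  have -> : Gauss 0 2 = Gauss 1 1 ^+ 2 by apply: gaussE.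
  by rewrite /qform; ring.
rewrite gauss_normM (_ : gauss_norm (Gauss 0 2) = 4) //.
apply/dvdzP; exists (qform k1 l1 * qform km lm * gauss_norm (qform a' b')).
by rewrite kE1 lE1 kEm lEm /qform; ring.
Qed.

Section Necessity.

Variables (s1 sm : int) (s : gauss) (a1 am : int) (a : gauss).
Variables (b1 bm : int) (b : gauss).
Hypotheses (gs : glued s1 sm s) (ga : glued a1 am a) (gb : glued b1 bm b).
Hypothesis mod3 : [&& 3 %| s1 - a1 - b1, 3 %| sm - am - bm,
  3 %| re s - re a - re b & 3 %| im s - im a - im b]%Z.

Let q1 := qform a1 b1.
Let qm := qform am bm.
Let h := qform a b.
Let n := det_value s1 sm s a1 b1 am bm a b.

Let nE : n = s1 * sm * gauss_norm s * (q1 * qm * gauss_norm h).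
Proof. by rewrite /n /det_value /q1 /qm /h; ring. Qed.

Let glued_q : glued q1 qm h.
Proof. exact: glued_qform. Qed.

(** The form is congruent to [(v + w) ^+ 2] modulo 3, as w = 1 modulo the prime above 3. *)
Let qform_mod3 (u v w : int) : (3 %| u - v - w)%Z -> (3 %| qform v w - u ^+ 2)%Z.
Proof.
case/dvdzP=> k kE; apply/dvdzP; exists (- v * w - k * (u + v + w)).
have -> : u = v + w + k * 3 by rewrite -kE; ring.
by rewrite /qform; ring.
Qed.

Let q1_dvd3 : (3 %| q1)%Z = (3 %| s1)%Z.
Proof.
have /and4P[h1 _ _ _] := mod3; have := qform_mod3 h1; rewrite -/q1 expr2.
by have := dvd3M s1 s1; move: (s1 * s1) => *; lia.
Qed.

Let qm_dvd3 : (3 %| qm)%Z = (3 %| sm)%Z.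
Proof.
have /and4P[_ h1 _ _] := mod3; have := qform_mod3 h1; rewrite -/qm expr2.
by have := dvd3M sm sm; move: (sm * sm) => *; lia.
Qed.

Let h_mod3 : (3 %| re h - re (s * s))%Z && (3 %| im h - im (s * s))%Z.
Proof.
have /and4P[_ _ /dvdzP[k kE] /dvdzP[l lE]] := mod3.
have sE : s = a + b + Gauss k l * Gauss 3 0.
  by apply: gaussE; rewrite !reimE /=; lia.
have -> : h = s * s + Gauss 3 0 * (- a * b - Gauss k l * (s + a + b)).
  by rewrite /h /qform sE; have -> : Gauss 3 0 = 3%:R; [apply: gaussE | ring].
rewrite [re (s * s + _)]reD [im (s * s + _)]imD.
by rewrite [re (Gauss 3 0 * _)]reM [im (Gauss 3 0 * _)]imM /=; lia.
Qed.

Let gauss_norm_dvd3 (z : gauss) :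
  (3 %| gauss_norm z)%Z = (3 %| re z)%Z && (3 %| im z)%Z.
Proof.
rewrite /gauss_norm !expr2; case: z => x y /=.
have sq (u : int) : (3 %| u)%Z && (3 %| u * u)%Z
     || ((u * u) %% 3 == 1)%Z && ~~ (3 %| u)%Z.
  have [k [r [-> r_bd]]] : exists k r : int, u = 3 * k + r /\ 0 <= r < 3.
    by exists (u %/ 3)%Z, (u %% 3)%Z; lia.
  have -> : (3 * k + r) * (3 * k + r) = 3 * (3 * k * k + 2 * k * r) + r * r by ring.
  move: (3 * k * k + 2 * k * r) => t.
  have [->|[->|->]] : r = 0 \/ r = 1 \/ r = 2 by lia.
  - by lia.
  - by lia.
  - by lia.
by have := sq x; have := sq y; move: (x * x) (y * y) => *; lia.
Qed.

Let h_dvd3 : (3 %| gauss_norm h)%Z = (3 %| gauss_norm s)%Z.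
Proof.
have -> : (3 %| gauss_norm s)%Z = (3 %| gauss_norm (s * s))%Z.
  by rewrite gauss_normM dvd3M orbb.
by rewrite !gauss_norm_dvd3; have := h_mod3; lia.
Qed.

Let gauss_norm_dvd9 (z : gauss) : (3 %| gauss_norm z)%Z -> (9 %| gauss_norm z)%Z.
Proof.
rewrite gauss_norm_dvd3 /gauss_norm; case: z => x y /= /andP[].
move=> /dvdzP[k ->] /dvdzP[l ->]; apply/dvdzP; exists (k ^+ 2 + l ^+ 2); ring.
Qed.

Lemma det_value_dvd16 : (2 %| n)%Z -> (16 %| n)%Z.
Proof.
rewrite nE dvd2M => /orP[] hn.
  by rewrite dvdz_mulr // glued_even16.
rewrite dvdz_mull //; apply: dvdz_trans (glued_qform_even64 ga gb hn).
by [].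
Qed.

Lemma det_value_dvd9 : (3 %| n)%Z -> (9 %| n)%Z.
Proof.
rewrite nE !dvd3M q1_dvd3 qm_dvd3 h_dvd3.
have dvd9 u v : (3 %| u)%Z -> (3 %| v)%Z = (3 %| u)%Z -> (9 %| u * v)%Z.
  by move=> hu; rewrite hu => hv; apply: (@dvdz_mul 3 3).
(* Each value of [S] is paired with its form, which is divisible by 3 exactly when that value (at i,
   its norm) is. *)
have -> : s1 * sm * gauss_norm s * (q1 * qm * gauss_norm h)
    = s1 * q1 * (sm * qm * (gauss_norm s * gauss_norm h)) by ring.
move=> hn; have {hn} : [|| 3 %| s1, 3 %| sm | 3 %| gauss_norm s]%Z by lia.
case/or3P => [h1|hm|hs].
- by rewrite dvdz_mulr // dvd9.
- by rewrite dvdz_mull // dvdz_mulr // dvd9.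
- by rewrite dvdz_mull // dvdz_mull // dvd9.
Qed.

(** With [w] on an axis, the square of c (1 + i) [w] has real part divisible by 3. So does [h],
    which must then lie on the imaginary axis modulo 6. *)
Lemma det_value_even_re : ~~ (3 %| gauss_norm h)%Z ->
  free_of_admissible (gauss_norm h) ->
  forall (c : int) (w : gauss), s = Gauss c c * w ->
  free_of_admissible (gauss_norm w) -> (2 %| re h)%Z.
Proof.
move=> h3 h_free c w sE w_free.
have h_ax := gauss_free_axis6 h_free; have w_ax := gauss_free_axis6 w_free.
have re_ss : (3 %| re (s * s))%Z.
  have -> : re (s * s) = - 4 * c ^+ 2 * (re w * im w).
    by rewrite sE !reimE /=; ring.
  by rewrite dvdz_mull // dvd3M; move: w_ax; rewrite /axis6; lia.
have [h2 _ _] := h_free; move: h2 h3 h_ax.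
rewrite dvd2_gauss_norm gauss_norm_dvd3 /axis6.
by have /andP[] := h_mod3; lia.
Qed.

(** Here [s] is on an axis, so [s * s] and hence [h] are real modulo 3; thus 6 divides [im h], and
    [re h] is odd since the norm is. *)
Lemma det_value_odd_re : ~~ (3 %| gauss_norm h)%Z ->
  free_of_admissible (gauss_norm h) -> free_of_admissible (gauss_norm s) ->
  ~~ (2 %| re h)%Z.
Proof.
move=> h3 h_free s_free.
have h_ax := gauss_free_axis6 h_free; have s_ax := gauss_free_axis6 s_free.
have im_ss : (3 %| im (s * s))%Z.
  have -> : im (s * s) = 2 * (re s * im s) by rewrite !reimE; ring.
  by rewrite dvdz_mull // dvd3M; move: s_ax; rewrite /axis6; lia.
have [h2 _ _] := h_free; move: h2 h3 h_ax.
rewrite dvd2_gauss_norm gauss_norm_dvd3 /axis6.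
by have /andP[] := h_mod3; lia.
Qed.

Let coprime_dvd (d m k : int) : coprimez d k -> (d %| k * m)%Z -> (d %| m)%Z.
Proof. by move=> dk; rewrite Gauss_dvdzr. Qed.

Lemma det_value_32 (m : int) : n = 32 * m -> ~~ (2 %| m)%Z -> ~~ (3 %| m)%Z ->
  exists p, admissible_prime p /\ (p%:Z %| m)%Z.
Proof.
move=> nm m2 m3; apply: NNPP => no_p.
have m_free : free_of_admissible m.
  split=> // p p_adm; apply/negP => p_dvd; apply: no_p; by exists p.
pose Q := q1 * qm * gauss_norm h.
have odd_dvd d : ~~ (2 %| d)%Z -> (d %| n)%Z -> (d %| m)%Z.
  rewrite nm => d2; apply: coprime_dvd.
  rewrite (_ : 32 = 2 ^+ 5) // coprimezXr // coprimezE coprimen2 /=.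
  by move: d2; rewrite dvdzE dvdn2 negbK.
(* An even [Q] would already contribute 64, so the factor 32 comes from the values of [S]. *)
have Q_odd : ~~ (2 %| Q)%Z.
  apply: contra m2 => /(glued_qform_even64 ga gb) Q64.
  have : (64 %| n)%Z by rewrite nE dvdz_mull.
  by rewrite nm; lia.
have Qn : (Q %| n)%Z by rewrite nE dvdz_mull.
have /dvdzP[m' m'E] := odd_dvd _ Q_odd Qn.
have Q_neq0 : Q != 0 by apply: contraNneq Q_odd => ->.
have [||c [w [sE w_odd]]] := @glued_exactly32 s1 sm m' s gs.
- apply: (mulIf Q_neq0); rewrite -[LHS]/(_ * (q1 * qm * gauss_norm h)) -nE nm m'E.
  by ring.
- by apply: contra m2; rewrite m'E => h2; rewrite dvdz_mulr.
have free_dvd d : (d %| Q)%Z -> free_of_admissible d.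
  move=> dQ; apply: free_of_admissible_dvd m_free.
  by rewrite m'E dvdz_mull.
have w_free : free_of_admissible (gauss_norm w).
  apply: free_of_admissible_dvd m_free; apply: odd_dvd => //.
  by rewrite nE sE gauss_normM dvdz_mulr // dvdz_mull // dvdz_mull.
have h_free : free_of_admissible (gauss_norm h) by apply: free_dvd; rewrite dvdz_mull.
have [_ h3 _] := h_free.
have re_h := det_value_even_re h3 h_free sE w_free.
have q1_4 : (q1 %% 4)%Z = 1.
  by apply: qform_free_mod4; apply: free_dvd; rewrite /Q -mulrA dvdz_mulr.
have qm_4 : (qm %% 4)%Z = 1.
  by apply: qform_free_mod4; apply: free_dvd; rewrite /Q mulrAC dvdz_mull.
(* Gluing requires [q1 + qm] to equal [2 * re h] modulo 4, but the former is 2 and the latter 0. *)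
by move: glued_q; rewrite gluedP; lia.
Qed.

(** The sum [v + w] is divisible by 3, so the element with coordinates [v], [w] is divisible by the
    prime 1 - w of Z[w], of norm 3; the witnesses are the coordinates of the quotient. *)
Let qform_div3 (u v w : int) : (3 %| u - v - w)%Z -> (3 %| u)%Z ->
  exists v' w', qform v w = 3 * qform v' w'.
Proof.
move=> h1 h2; exists ((2 * v - w) %/ 3)%Z, ((v + w) %/ 3)%Z.
have [k kE] : exists k, w = 3 * k - v by exists ((v + w) %/ 3)%Z; lia.
have -> : ((2 * v - w) %/ 3)%Z = v - k by lia.
have -> : ((v + w) %/ 3)%Z = k by lia.
by rewrite kE /qform; ring.
Qed.

Lemma det_value_9 (m : int) : n = 9 * m -> ~~ (2 %| m)%Z -> ~~ (3 %| m)%Z ->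
  exists p, admissible_prime p /\ (p%:Z %| m)%Z.
Proof.
move=> nm m2 m3; apply: NNPP => no_p.
have m_free : free_of_admissible m.
  split=> // p p_adm; apply/negP => p_dvd; apply: no_p; by exists p.
have m_inj x : 9 * x = n -> x = m.
  by rewrite nm; apply: mulfI.
(* If 3 divided the norm of [s], both norms at i would be divisible by 9, and [n] by 81. *)
have [s3|s3] := boolP (3 %| gauss_norm s)%Z.
  have : (9 * 9 %| n)%Z.
    have -> : n = s1 * sm * (q1 * qm) * (gauss_norm s * gauss_norm h).
      by rewrite nE; ring.
    by rewrite dvdz_mull // dvdz_mul // gauss_norm_dvd9 // h_dvd3.
  by rewrite nm dvdz_mul2l //; lia.
have h3 : ~~ (3 %| gauss_norm h)%Z by rewrite h_dvd3.
(* The factor 9 comes from 1 or from -1, where a form is 3 times a form that is 1 modulo 4. Then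
   [q1 + qm] is 0 modulo 4, against [2 * re h] with [re h] odd. *)
have final (r q1' qm' : int) : m = r * q1' * qm' * gauss_norm s * gauss_norm h ->
    (free_of_admissible q1' -> free_of_admissible qm' -> (4 %| q1 + qm)%Z) -> False.
  move=> mE q4.
  have free_dvd d : (d %| m)%Z -> free_of_admissible d.
    by move=> dm; apply: free_of_admissible_dvd m_free.
  have h_free : free_of_admissible (gauss_norm h).
    by apply: free_dvd; rewrite mE dvdz_mull.
  have s_free : free_of_admissible (gauss_norm s).
    by apply: free_dvd; rewrite mE dvdz_mulr // dvdz_mull.
  have q1_free : free_of_admissible q1'.
    by apply: free_dvd; rewrite mE; do 3![apply: dvdz_mulr]; apply: dvdz_mull.
  have qm_free : free_of_admissible qm'.
    by apply: free_dvd; rewrite mE; do 2![apply: dvdz_mulr]; apply: dvdz_mull.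
  have := det_value_odd_re h3 h_free s_free; have := q4 q1_free qm_free.
  by move: glued_q; rewrite gluedP; lia.
have /and4P[m1 mm _ _] := mod3.
have : [|| 3 %| s1, 3 %| sm | 3 %| gauss_norm s]%Z.
  have : (3 %| n)%Z by rewrite nm dvdz_mulr.
  by rewrite nE !dvd3M q1_dvd3 qm_dvd3 h_dvd3; lia.
rewrite (negPf s3) orbF => /orP[d3|d3].
  have [v [w q1E]] := qform_div3 m1 d3; case/dvdzP: d3 => t tE.
  apply: (final (t * sm) (qform v w) qm) => [|f1 fm].
    by apply/esym/m_inj; rewrite nE /q1 q1E tE; ring.
  have := qform_free_mod4 f1; have : (qm %% 4)%Z = 1 := qform_free_mod4 fm.
  by rewrite /q1 q1E; lia.
have [v [w qmE]] := qform_div3 mm d3; case/dvdzP: d3 => t tE.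
apply: (final (t * s1) q1 (qform v w)) => [|f1 fm].
  by apply/esym/m_inj; rewrite nE /qm qmE tE; ring.
have := qform_free_mod4 fm; have : (q1 %% 4)%Z = 1 := qform_free_mod4 f1.
by rewrite /qm qmE; lia.
Qed.

End Necessity.

(** * Realization of values *)

Lemma int_group_dets_of_values (n s1 sm : int) (s : gauss) (a1 am : int)
    (a : gauss) (b1 bm : int) (b : gauss) :
  glued s1 sm s -> glued a1 am a -> glued b1 bm b ->
  [&& 3 %| s1 - a1 - b1, 3 %| sm - am - bm,
      3 %| re s - re a - re b & 3 %| im s - im a - im b]%Z ->
  n = det_value s1 sm s a1 b1 am bm a b -> int_group_dets 'Z_12 n.
Proof.
move=> gs ga gb h3 nE; apply/int_group_dets_Z12P.
by exists s1, sm, s, a1, am, a, b1, bm, b.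
Qed.

Lemma int_group_dets_N1 : int_group_dets 'Z_12 (-1).
Proof.
by apply: (@int_group_dets_of_values _ (-1) 1 (Gauss 0 1) (-1) 1 (Gauss 0 1) 0 0 0);
  rewrite ?gluedP.
Qed.

Lemma int_group_dets_opp (n : int) :
  int_group_dets 'Z_12 n -> int_group_dets 'Z_12 (- n).
Proof. by rewrite -mulN1r; apply: int_group_detsM int_group_dets_N1. Qed.

(** Up to sign [m] is 1 or 5 modulo 12, and it can be the value of [S] at 1, all other factors being
    1. *)
Lemma int_group_dets_coprime6 (m : int) :
  ~~ (2 %| m)%Z -> ~~ (3 %| m)%Z -> int_group_dets 'Z_12 m.
Proof.
have m1 (k : int) : (12 %| k - 1)%Z -> int_group_dets 'Z_12 k.
  move=> hk; apply: (@int_group_dets_of_values _ k 1 1 1 1 1 0 0 0);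
    rewrite ?gluedP /=; [lia | lia | by [] | lia |].
  by rewrite /det_value /qform /gauss_norm !reimE /=; ring.
(* The sign change of [A] at 1, forced modulo 3, is compensated at i by a nontrivial unit of
   Z[i, w]. *)
have m5 (k : int) : (12 %| k - 5)%Z -> int_group_dets 'Z_12 k.
  move=> hk; apply: (@int_group_dets_of_values _ k 1 1 (-1) 1
    (Gauss (-2) (-1)) 0 0 (Gauss 0 (-2))); rewrite ?gluedP /=;
    [lia | by [] | by [] | lia |].
  by rewrite /det_value (_ : gauss_norm (qform (Gauss (-2) (-1)) (Gauss 0 (-2))) = 1) //
       /qform; ring.
move=> m2 m3; have : [|| 12 %| m - 1, 12 %| m - 5,
                      12 %| - m - 1 | 12 %| - m - 5]%Z by lia.
case/or4P => [/m1|/m5|/m1/int_group_dets_opp|/m5/int_group_dets_opp] //;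
  by rewrite opprK.
Qed.

Lemma int_group_dets_16 : int_group_dets 'Z_12 16.
Proof.
by apply: (@int_group_dets_of_values _ (-2) (-2) (Gauss (-2) 0) 1 1 1 0 0 0);
  rewrite ?gluedP.
Qed.

(** At 1, [S] contributes [3 * k] and the form [qform 3 0 = 9]. *)
Lemma int_group_dets_27 (m : int) : ~~ (2 %| m)%Z -> int_group_dets 'Z_12 (27 * m).
Proof.
have m1 (k : int) : (4 %| k - 1)%Z -> int_group_dets 'Z_12 (27 * k).
  move=> hk; apply: (@int_group_dets_of_values _ (3 * k) 1 (Gauss 0 1) 3 1
    (Gauss 0 1) 0 0 0); rewrite ?gluedP /=;
    [lia | by [] | by [] | lia |].
  by rewrite /det_value /qform /gauss_norm !reimE /=; ring.
move=> m2; have /orP[/m1|/m1/int_group_dets_opp] // :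
    (4 %| m - 1)%Z || (4 %| - m - 1)%Z.
  by lia.
by rewrite mulrN opprK.
Qed.

Lemma int_group_dets_64 (m : int) : ~~ (3 %| m)%Z -> int_group_dets 'Z_12 (64 * m).
Proof.
have m1 (k : int) : (3 %| k - 1)%Z -> int_group_dets 'Z_12 (64 * k).
  move=> hk; apply: (@int_group_dets_of_values _ (4 * k) 4 (Gauss (-2) 0) 1 1
    1 0 0 0); rewrite ?gluedP /=;
    [lia | by [] | by [] | lia |].
  by rewrite /det_value /qform /gauss_norm !reimE /=; ring.
move=> m3; have /orP[/m1|/m1/int_group_dets_opp] // :
    (3 %| m - 1)%Z || (3 %| - m - 1)%Z.
  by lia.
by rewrite mulrN opprK.
Qed.

(** The values of [S] contribute [12 * m], 2 and the norm 2; [qform 1 (-1)] supplies the remaining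
    3. *)
Lemma int_group_dets_144 (m : int) : int_group_dets 'Z_12 (144 * m).
Proof.
apply: (@int_group_dets_of_values _ (12 * m) 2 (Gauss 1 (-1)) 1 1 1
  (-1) 1 (Gauss 0 (-1))); rewrite ?gluedP /=;
    [lia | by [] | by [] | lia |].
by rewrite /det_value /qform /gauss_norm !expr2 !reimE /=; ring.
Qed.

Lemma prime5_squares (p : nat) : prime p -> (p %% 12 = 5)%N ->
  exists a b : int, p%:Z = a ^+ 2 + b ^+ 2
    /\ [&& ~~ (2 %| a), 2 %| b, 3 %| a - 1 & 3 %| b - 1]%Z.
Proof.
move=> p_pr p5.
have wlog_odd (c d : int) : p%:Z = c ^+ 2 + d ^+ 2 -> ~~ (2 %| c)%Z ->
    exists a b : int, p%:Z = a ^+ 2 + b ^+ 2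
    /\ [&& ~~ (2 %| a), 2 %| b, 3 %| a - 1 & 3 %| b - 1]%Z.
  move=> cd c_odd.
  have [c' [q [cE q_bd]]] : exists k r : int, c = 6 * k + r /\ -3 <= r < 3.
    by exists ((c + 3) %/ 6)%Z, (((c + 3) %% 6)%Z - 3); lia.
  have [d' [r [dE r_bd]]] : exists k r : int, d = 6 * k + r /\ -3 <= r < 3.
    by exists ((d + 3) %/ 6)%Z, (((d + 3) %% 6)%Z - 3); lia.
  have qr : ((q ^+ 2 + r ^+ 2) %% 12)%Z = 5.
    have pE : p%:Z = 12 * (3 * c' ^+ 2 + c' * q + 3 * d' ^+ 2 + d' * r)
      + (q ^+ 2 + r ^+ 2) by rewrite cd cE dE; ring.
    by move: pE; move: (3 * c' ^+ 2 + _ + _ + _) (q ^+ 2 + r ^+ 2) => *; lia.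
  (* Being 5 modulo 12 excludes multiples of 3, so signs can be chosen to make both coordinates 1
     modulo 3. *)
  have [c1 d1] : ((c == 6 * c' + 1) || (c == 6 * c' - 1))
      /\ ((d == 6 * d' + 2) || (d == 6 * d' - 2)).
    have dq : [|| q == -3, q == -1 | q == 1] by lia.
    have dr : [|| r == -3, r == -2, r == -1 | [|| r == 0, r == 1 | r == 2]] by lia.
    case/or3P: dq => /eqP qE; case/or4P: dr => [/eqP rE|/eqP rE|/eqP rE|/or3P[]/eqP rE];
    by move/eqP: qr; rewrite qE rE => // _; rewrite cE dE qE rE; lia.
  by case/orP: c1 => /eqP c1; case/orP: d1 => /eqP d1;
    [exists c, (- d) | exists c, d | exists (- c), (- d) | exists (- c), d];
    rewrite ?sqrrN; split=> //; lia.
have [|c [d cd]] := prime_sum_two_squares p_pr; first by lia.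
have [c_even|c_odd] := boolP (2 %| c)%Z; last exact: wlog_odd cd c_odd.
apply: (wlog_odd d c); first by rewrite cd addrC.
move: cd; rewrite !expr2; case/dvdzP: c_even => k ->.
have := dvd2M d d; have -> : k * 2 * (k * 2) = 2 * (2 * k * k) by ring.
by move: (d * d) (2 * k * k) => *; lia.
Qed.

(** The prime is the norm of [S] at i, after multiplication by 1 + i in the second case. *)
Lemma int_group_dets_p5 (p : nat) : prime p -> (p %% 12 = 5)%N ->
  int_group_dets 'Z_12 (9 * p%:Z) /\ int_group_dets 'Z_12 (32 * p%:Z).
Proof.
move=> p_pr p5; have [a [b [pE /and4P[a2 b2 a3 b3]]]] := prime5_squares p_pr p5.
rewrite -[9 * _]opprK -[32 * _]opprK; split; apply: int_group_dets_opp.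
  apply: (@int_group_dets_of_values _ 3 (-1) (Gauss a b) 1 1 1
    (-1) 1 (Gauss 0 1)); rewrite ?gluedP /=;
    [lia | by [] | by [] | lia |].
  rewrite /det_value (_ : gauss_norm (qform 1 (Gauss 0 1)) = 1) //.
  by rewrite pE /qform /gauss_norm /=; ring.
apply: (@int_group_dets_of_values _ (-8) 2 (Gauss (a - b) (a + b)) 1 (-1)
  (Gauss 0 (-1)) 0 0 0); rewrite ?gluedP /=;
    [lia | by [] | by [] | lia |].
rewrite /det_value (_ : gauss_norm (qform (Gauss 0 (-1)) 0) = 1) //.
by rewrite pE /qform /gauss_norm /=; ring.
Qed.

(** Multiplication by powers of w makes [x] odd and [y] even; a value 3 modulo 4 then forces [y] to
    be 2 modulo 4, and a common sign change adjusts [x]. *)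
Lemma prime7_qform (p : nat) : prime p -> (p %% 12 = 7)%N ->
  exists x y : int, p%:Z = qform x y /\ (4 %| x - 1)%Z && (4 %| y - 2)%Z.
Proof.
move=> p_pr p7.
pose good (u v : int) := exists x y : int,
  qform u v = qform x y /\ (4 %| x - 1)%Z && (4 %| y - 2)%Z.
have [|u [v uvE]] := prime_qform p_pr; first by lia.
suff [x [y [e xy]]] : good u v by exists x, y; rewrite uvE.
have good1 x y : (qform x y %% 4)%Z = 3 -> ~~ (2 %| x)%Z -> (2 %| y)%Z -> good x y.
  move=> h x_odd /dvdzP[k kE].
  have k_odd : ~~ (2 %| k)%Z.
    apply/negP => /dvdzP[l lE].
    have [t tE] : exists t, x = 2 * t + 1 by exists (x %/ 2)%Z; lia.
    have : qform x y = 4 * (t * t + t - 2 * t * l - l + 4 * l * l) + 1.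
      by rewrite kE lE tE /qform; ring.
    by move: h; move: (qform x y) (t * t + _ - _ - _ + _) => *; lia.
  have [x1|x1] := boolP (4 %| x - 1)%Z; first by exists x, y; split=> //; lia.
  by exists (- x), (- y); split; [rewrite /qform; ring | lia].
have h3 : (qform u v %% 4)%Z = 3 by rewrite -uvE; lia.
have rot (x y : int) : qform x y = qform (- y) (x - y) by rewrite /qform; ring.
have [u2|u2] := boolP (2 %| u)%Z; have [v2|v2] := boolP (2 %| v)%Z.
- move: h3; rewrite /qform; case/dvdzP: u2 => k ->; case/dvdzP: v2 => l ->.
  have -> : (k * 2) ^+ 2 - k * 2 * (l * 2) + (l * 2) ^+ 2
      = 4 * (k * k - k * l + l * l) by ring.
  by move: (k * k - _ + _) => *; lia.
- have [|||x [y [e xy]]] := good1 (- (u - v)) (- v - (u - v)); rewrite -?rot //; try lia.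
  by exists x, y; rewrite (rot u v) (rot (- v)).
- exact: good1.
have [|||x [y [e xy]]] := good1 (- v) (u - v); rewrite -?rot //; try lia.
by exists x, y; rewrite (rot u v).
Qed.

(** The prime is the form at -1. The sign [e] lifts [x + y] modulo 3, which is nonzero because
    [qform x y] is [(x + y) ^+ 2] modulo 3. *)
Lemma int_group_dets_p7 (p : nat) : prime p -> (p %% 12 = 7)%N ->
  int_group_dets 'Z_12 (9 * p%:Z) /\ int_group_dets 'Z_12 (32 * p%:Z).
Proof.
move=> p_pr p7; have [x [y [pE /andP[x4 y4]]]] := prime7_qform p_pr p7.
have [e e1 xy3] : exists2 e : int, (e == 1) || (e == -1) & (3 %| e - x - y)%Z.
  have : ~~ (3 %| x + y)%Z.
    apply/negP => /dvdzP[k kE]; have : (3 %| p%:Z)%Z.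
      apply/dvdzP; exists (3 * k ^+ 2 - x * y); rewrite pE /qform.
      by have -> : x = k * 3 - y by [rewrite -kE; ring]; ring.
    by lia.
  move=> xy; have [h|h] := boolP (3 %| 1 - x - y)%Z.
    by exists 1.
  by exists (-1); lia.
have ee : e * e = 1 by case/orP: e1 => /eqP ->.
split.
  rewrite -[9 * _]opprK; apply: int_group_dets_opp.
  apply: (@int_group_dets_of_values _ (- (3 * e)) e 1 1 x 1 2 y 0);
    rewrite ?gluedP /=; [lia | lia | lia | lia |].
  rewrite /det_value (_ : gauss_norm (qform 1 0) = 1) //.
  transitivity (- (9 * (e * e) * qform x y)); first by rewrite ee pE mulr1.
  by rewrite (_ : qform 1 2 = 3) //; ring.
have : int_group_dets 'Z_12 (32 * e * p%:Z).
  apply: (@int_group_dets_of_values _ (-8) (-2 * e) (Gauss (-1) 1) 1 x 1 0 y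
    (Gauss 1 1)); rewrite ?gluedP /=; [lia | lia | lia | lia |].
  rewrite /det_value (_ : gauss_norm (qform 1 (Gauss 1 1)) = 1) //.
  by rewrite (_ : gauss_norm (Gauss (-1) 1) = 2) // pE /qform; ring.
case/orP: e1 => /eqP ->; first by rewrite mulr1.
by rewrite mulrN1 mulNr => /int_group_dets_opp; rewrite opprK.
Qed.

Lemma qform_rot (R : comNzRingType) (a b : R) : qform (- b) (a - b) = qform a b.
Proof. by rewrite /qform; ring. Qed.

Lemma qform_scale (R : comNzRingType) (c a b : R) :
  qform (c * a) (c * b) = c ^+ 2 * qform a b.
Proof. by rewrite /qform; ring. Qed.

(* Multiplication by the unit [1 - i w] of relative norm [i]. *)
Lemma qform_unit (a b : gauss) :
  qform (a + Gauss 0 1 * b) (b - Gauss 0 1 * a + Gauss 0 1 * b)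
  = Gauss 0 1 * qform a b.
Proof. by apply: gaussE; rewrite /qform !expr2 !reimE /=; ring. Qed.

(* The units generated by [w], [i] and [1 - i w] act transitively on the residues
   modulo 2 prime to 2, so the residue can be taken to be 1. *)
Lemma qform_gauss_unit_mod2 (a b : gauss) : ~~ (2 %| gauss_norm (qform a b))%Z ->
  exists a' b', gauss_norm (qform a' b') = gauss_norm (qform a b)
    /\ [&& ~~ (2 %| re a'), 2 %| im a', 2 %| re b' & 2 %| im b']%Z.
Proof.
pose N a b := gauss_norm (qform a b).
pose good a b := exists a' b', N a' b' = N a b
    /\ [&& ~~ (2 %| re a'), 2 %| im a', 2 %| re b' & 2 %| im b']%Z.
have mono a1 b1 a2 b2 : N a2 b2 = N a1 b1 -> good a2 b2 -> good a1 b1.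
  by move=> e [x [y [xy h]]]; exists x, y; rewrite xy e.
have good_rot x y : good (- y) (x - y) -> good x y.
  by apply: mono; rewrite /N qform_rot.
have good_i x y : good (Gauss 0 1 * x) (Gauss 0 1 * y) -> good x y.
  by apply: mono; rewrite /N qform_scale gauss_normM mul1r.
have good_unit x y : good (x + Gauss 0 1 * y) (y - Gauss 0 1 * x + Gauss 0 1 * y)
    -> good x y.
  by apply: mono; rewrite /N qform_unit gauss_normM mul1r.
have good1 x y : [&& ~~ (2 %| re x), 2 %| im x, 2 %| re y & 2 %| im y]%Z -> good x y.
  by exists x, y.
have good2 x y : [&& ~~ (2 %| re x), 2 %| im x, ~~ (2 %| re y) & 2 %| im y]%Z ->
    good x y.
  move=> h; apply/good_rot/good1; move: h; rewrite !reimE; lia.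
have good3 x y : [&& 2 %| re x, 2 %| im x, ~~ (2 %| re y) & 2 %| im y]%Z ->
    good x y.
  move=> h; apply/good_rot/good2; move: h; rewrite !reimE; lia.
have good4 x y : (2 %| im x)%Z -> (2 %| im y)%Z ->
    ~~ (2 %| re x)%Z || ~~ (2 %| re y)%Z -> good x y.
  by move=> h1 h2 h3; case: (boolP (2 %| re x)%Z) => h4;
    case: (boolP (2 %| re y)%Z) => h5;
    [lia | apply: good3 | apply: good1 | apply: good2]; lia.
have good5 x y : (2 %| re x)%Z -> (2 %| re y)%Z ->
    ~~ (2 %| im x)%Z || ~~ (2 %| im y)%Z -> good x y.
  by move=> h1 h2 h3; apply/good_i/good4; rewrite !reimE /=; lia.
rewrite dvd2_gauss_norm => h_odd.
suff [x [y [xy h]]] : good a b by exists x, y.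
(* An odd norm means that 1 + i does not divide both [a] and [b]. *)
have {}h_odd : ~~ ((2 %| re a + im a) && (2 %| re b + im b))%Z.
  apply: contra h_odd; rewrite -!dvd2_gauss_norm => /andP[/gauss_div_1i[u ->]].
  move=> /gauss_div_1i[v ->]; rewrite qform_scale gauss_normM.
  by rewrite dvdz_mulr.
have [h1|h1] := boolP ((2 %| re a) && (2 %| re b))%Z.
  by apply: good5; lia.
have [h2|h2] := boolP ((2 %| im a) && (2 %| im b))%Z.
  by apply: good4; lia.
apply: good_unit.
have [h3|h3] := boolP ((2 %| re a - im b) && (2 %| re b + im a - im b))%Z.
  by apply: good5; rewrite !reimE /=; lia.
by apply: good4; rewrite !reimE /=; lia.
Qed.

(** Modulo 3 the form is the square of [a + b], with imaginary part [2 * (x * y)]. This imaginary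
    part is even but, by [P1_primeP], not divisible by 6. *)
Lemma P1_prime_gauss_qform (p : nat) : P1_prime p -> exists a b : gauss,
  p%:Z = gauss_norm (qform a b)
  /\ [&& ~~ (2 %| re a), 2 %| im a, 2 %| re b, 2 %| im b,
         ~~ (3 %| re a + re b) & ~~ (3 %| im a + im b)]%Z.
Proof.
move=> P1; have [p_pr p1 _] := P1.
have {}p1 : (p %% 12 = 1)%N by rewrite p1.
have [c [d cd]] := prime_gauss_qform p_pr p1.
have [|a [b [ab /and4P[ha1 ha2 hb1 hb2]]]] := @qform_gauss_unit_mod2 c d.
  by rewrite -cd; lia.
rewrite -cd in ab; exists a, b; split=> //.
have := (P1_primeP p_pr p1 ab).1 P1; rewrite /axis6.
set x := re a + re b; set y := im a + im b.
have [l hl] : exists l : int, im (qform a b) = 2 * (x * y) + 3 * l.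
  exists (- re a * im b - im a * re b).
  by rewrite /qform !expr2 !reimE /x /y; ring.
have par : (2 %| im (qform a b))%Z.
  have /dvdzP[t tE] := hb1; have /dvdzP[j jE] := hb2; apply/dvdzP.
  exists (re a * im a + re b * im b - re a * j - im a * t).
  by rewrite /qform !expr2 !reimE jE tE; ring.
move=> ax; have : ~~ (3 %| x * y)%Z.
  by move: ax par; rewrite hl; move: (x * y) => *; lia.
by rewrite dvd3M negb_or ha1 ha2 hb1 hb2.
Qed.

Lemma int_group_dets_P1 (p : nat) : P1_prime p ->
  int_group_dets 'Z_12 (9 * p%:Z) /\ int_group_dets 'Z_12 (32 * p%:Z).
Proof.
move=> /P1_prime_gauss_qform[a [b [pE /and5P[a1 a2 b1 b2 /andP[x3 y3]]]]]; split.
  (* This unit multiplies [a + b] by 1 - i modulo 3, so exactly one coordinate of [a' + b'] becomes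
     divisible by 3, and [S] at i can be a unit of Z[i]. *)
  pose a' := a + Gauss 0 1 * b; pose b' := b - Gauss 0 1 * a + Gauss 0 1 * b.
  have p'E : gauss_norm (qform a' b') = p%:Z.
    by rewrite qform_unit gauss_normM mul1r -pE.
  have reE : re a' + re b' = re a + re b + (im a + im b) - 3 * im b.
    by rewrite !reimE /=; ring.
  have imE : im a' + im b' = im a + im b - (re a + re b) + 3 * re b.
    by rewrite !reimE /=; ring.
  have reA : re a' = re a - im b by rewrite !reimE /=; ring.
  have imA : im a' = im a + re b by rewrite !reimE /=; ring.
  have [h|h] := boolP (3 %| im a' + im b')%Z.
    have [e e1 eE] : exists2 e : int, (e == 1) || (e == -1)
        & (3 %| e - (re a' + re b'))%Z.
      have [?|?] := boolP (3 %| 1 - (re a' + re b'))%Z; first by exists 1.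
      by exists (-1); lia.
    rewrite -[9 * _]opprK; apply: int_group_dets_opp.
    apply: (@int_group_dets_of_values _ (3) (-1) (Gauss e 0) 1 1 a' (-1) 1 b');
      rewrite ?gluedP /=; [lia | lia | lia | lia |].
    by rewrite /det_value p'E; case/orP: e1 => /eqP ->; rewrite /qform /gauss_norm /=; ring.
  have [e e1 eE] : exists2 e : int, (e == 1) || (e == -1)
      & (3 %| e - (im a' + im b'))%Z.
    have [?|?] := boolP (3 %| 1 - (im a' + im b'))%Z; first by exists 1.
    by exists (-1); lia.
  apply: (@int_group_dets_of_values _ (-3) (-1) (Gauss 0 e) 1 1 a' (-1) 1 b');
    rewrite ?gluedP /=; [lia | lia | lia | lia |].
  by rewrite /det_value p'E; case/orP: e1 => /eqP ->; rewrite /qform /gauss_norm /=; ring.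
have [e e1 eE] : exists2 e : int, (e == 1) || (e == -1)
    & (3 %| e - (re a + re b))%Z.
  have [?|?] := boolP (3 %| 1 - (re a + re b))%Z; first by exists 1.
  by exists (-1); lia.
have [f f1 fE] : exists2 f : int, (f == 1) || (f == -1)
    & (3 %| f - (im a + im b))%Z.
  have [?|?] := boolP (3 %| 1 - (im a + im b))%Z; first by exists 1.
  by exists (-1); lia.
(* Here both coordinates of [a + b] are nonzero modulo 3, so [S] at i is [Gauss e f], of norm 2. *)
apply: (@int_group_dets_of_values _ (-8) (-2) (Gauss e f) 1 1 a 0 0 b);
  rewrite ?gluedP /=; [lia | lia | lia | lia |].
by rewrite /det_value pE; case/orP: e1 => /eqP ->; case/orP: f1 => /eqP ->;
  rewrite /qform /gauss_norm /=; ring.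
Qed.

(** * The classification *)

Lemma int_group_dets_admissible (p : nat) : admissible_prime p ->
  int_group_dets 'Z_12 (9 * p%:Z) /\ int_group_dets 'Z_12 (32 * p%:Z).
Proof.
case=> [[p_pr p5]|[p_pr p7]|]; last exact: int_group_dets_P1.
- exact: int_group_dets_p5.
- exact: int_group_dets_p7.
Qed.

Lemma admissible_prime_coprime6 (p : nat) : admissible_prime p ->
  ~~ (2 %| p%:Z)%Z && ~~ (3 %| p%:Z)%Z.
Proof. by case=> [[_ h]|[_ h]|[_ h _]]; lia. Qed.

Lemma coprimez2 (m : int) : coprimez m 2 = ~~ (2 %| m)%Z.
Proof. by rewrite coprimez_sym coprimezE prime_coprime. Qed.

Lemma coprimez3 (m : int) : coprimez m 3 = ~~ (3 %| m)%Z.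
Proof. by rewrite coprimez_sym coprimezE prime_coprime. Qed.

Lemma coprimez6 (m : int) : coprimez m 6 = ~~ (2 %| m)%Z && ~~ (3 %| m)%Z.
Proof. by rewrite -coprimez2 -coprimez3 -coprimezMr. Qed.

Lemma int_group_dets_dvd16 (n : int) :
  int_group_dets 'Z_12 n -> (2 %| n)%Z -> (16 %| n)%Z.
Proof.
case/int_group_dets_Z12P => s1 [sm [s [a1 [am [a [b1 [bm [b]]]]]]]].
by case=> gs ga gb _ ->; apply: det_value_dvd16.
Qed.

Lemma int_group_dets_dvd9 (n : int) :
  int_group_dets 'Z_12 n -> (3 %| n)%Z -> (9 %| n)%Z.
Proof.
case/int_group_dets_Z12P => s1 [sm [s [a1 [am [a [b1 [bm [b]]]]]]]].
by case=> gs ga gb h3 ->; apply: det_value_dvd9.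
Qed.

Lemma int_group_dets_factor (c n m : int) : int_group_dets 'Z_12 n ->
  (c == 9) || (c == 32) -> n = c * m -> ~~ (2 %| m)%Z -> ~~ (3 %| m)%Z ->
  exists (k : int) (p : nat),
    [/\ coprimez k 6, admissible_prime p & n = c * k * p%:Z].
Proof.
case/int_group_dets_Z12P => s1 [sm [s [a1 [am [a [b1 [bm [b]]]]]]]].
case=> gs ga gb h3 nE c_val nm m2 m3.
have [p [p_adm /dvdzP[k kE]]] : exists p, admissible_prime p /\ (p%:Z %| m)%Z.
  move: nm; rewrite nE; case/orP: c_val => /eqP ->.
    by move=> nm; apply: (det_value_9 ga gb h3 nm).
  by move=> nm; apply: (det_value_32 gs ga gb h3 nm).
exists k, p; split=> //; last by rewrite nm kE mulrA.
rewrite coprimez6; move: m2 m3; rewrite kE dvd2M dvd3M !negb_or.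
by move=> /andP[-> _] /andP[-> _].
Qed.

(* In ['Z_12] the group law is addition modulo 12. *)
Theorem theorem5p3 :
  ((forall n : int,
      [/\ int_group_dets 'Z_12 n, ~~ (2 %| n)%Z & coprimez n 3]
      <-> coprimez n 6)
   /\
   (forall n : int,
      [/\ int_group_dets 'Z_12 n, ~~ (2 %| n)%Z & (3 %| n)%Z]
      <->
      (exists (m : int) (p : nat),
         [/\ coprimez m 6, admissible_prime p & n = 9 * m * p%:Z])
      \/ (exists m : int, coprimez m 2 /\ n = 27 * m)))
  /\
  ((forall n : int,
      [/\ int_group_dets 'Z_12 n, (2 %| n)%Z & (3 %| n)%Z]
      <-> exists m : int, n = 2 ^+ 4 * 3 ^+ 2 * m)
   /\
   (forall n : int,
      [/\ int_group_dets 'Z_12 n, (2 %| n)%Z & coprimez n 3]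
      <->
      [\/ exists m : int, coprimez m 6 /\ n = 2 ^+ 4 * m,
          exists (m : int) (p : nat),
            [/\ coprimez m 6, admissible_prime p & n = 2 ^+ 5 * m * p%:Z]
        | exists m : int, coprimez m 3 /\ n = 2 ^+ 6 * m])).
Proof.
have detsM := @int_group_detsM 'Z_12.
split; split=> n.
- rewrite coprimez3 coprimez6; split=> [[_ -> ->] // | /andP[n2 n3]].
  by split=> //; apply: int_group_dets_coprime6.
- split=> [[dn n2 n3]|].
    have /dvdzP[k kE] := int_group_dets_dvd9 dn n3.
    have nE : n = 9 * k by rewrite kE mulrC.
    have [k3|k3] := boolP (3 %| k)%Z.
      right; exists (n %/ 27)%Z; rewrite coprimez2; lia.
    by left; apply: (int_group_dets_factor dn _ nE) => //; lia.
  case=> [[m [p [m6 p_adm ->]]] | [m [m2 ->]]]; last first.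
    rewrite coprimez2 in m2.
    by split; [apply: int_group_dets_27 | lia | lia].
  move: m6; rewrite coprimez6 => /andP[m2 m3].
  have /andP[p2 p3] := admissible_prime_coprime6 p_adm.
  split; last by rewrite -mulrA dvdz_mulr.
    have -> : 9 * m * p%:Z = m * (9 * p%:Z) by ring.
    apply: detsM; first exact: int_group_dets_coprime6.
    by have [] := int_group_dets_admissible p_adm.
  by rewrite !dvd2M (negPf m2) (negPf p2).
- split=> [[dn n2 n3]|[m ->]].
    have n16 := int_group_dets_dvd16 dn n2; have n9 := int_group_dets_dvd9 dn n3.
    by exists (n %/ 144)%Z; rewrite (_ : 2 ^+ 4 * 3 ^+ 2 = 144) //; lia.
  rewrite (_ : 2 ^+ 4 * 3 ^+ 2 = 144) //.
  by split; [apply: int_group_dets_144 | lia | lia].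
rewrite (_ : 2 ^+ 4 = 16) // (_ : 2 ^+ 5 = 32) // (_ : 2 ^+ 6 = 64) //.
split=> [[dn n2]|].
  rewrite coprimez3 => n3; have n16 := int_group_dets_dvd16 dn n2.
  (* The three families correspond to 2-adic valuation 4, at least 6, and exactly 5. *)
  have [n32|n32] := boolP (32 %| n)%Z; last first.
    by constructor 1; exists (n %/ 16)%Z; rewrite coprimez6; lia.
  have [n64|n64] := boolP (64 %| n)%Z.
    by constructor 3; exists (n %/ 64)%Z; rewrite coprimez3; lia.
  have /dvdzP[k kE] := n32; have nE : n = 32 * k by rewrite kE mulrC.
  by constructor 2; apply: (int_group_dets_factor dn _ nE) => //; lia.
case=> [[m [m6 ->]]|[m [p [m6 p_adm ->]]]|[m [m3 ->]]].
- move: m6; rewrite coprimez6 coprimez3 => /andP[m2 m3].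
  split; [|lia|lia]; apply: detsM; first exact: int_group_dets_16.
  exact: int_group_dets_coprime6.
- move: m6; rewrite coprimez6 => /andP[m2 m3].
  have /andP[p2 p3] := admissible_prime_coprime6 p_adm.
  split; last by rewrite coprimez3 !dvd3M (negPf m3) (negPf p3).
    have -> : 32 * m * p%:Z = m * (32 * p%:Z) by ring.
    apply: detsM; first exact: int_group_dets_coprime6.
    by have [] := int_group_dets_admissible p_adm.
  by rewrite -mulrA dvdz_mulr.
- rewrite coprimez3 in m3.
  by split; [apply: int_group_dets_64 | lia | rewrite coprimez3; lia].
Qed.
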